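(* Suppose the reward satisfies $|R(s,a)|\le U_R$ for all $(s,a)\in\mathcal S\times\mathcal A$, and that $\pi_\theta$ is differentiable in $\theta$ with score function $\nabla\log\pi_\theta(a\mid s)$ that exists and satisfies, for all $(s,a)$ and all $\theta,\theta^1,\theta^2\in\mathbb R^d$, $\|\nabla\log\pi_{\theta^1}(a\mid s)-\nabla\log\pi_{\theta^2}(a\mid s)\|\le L_\Theta\|\theta^1-\theta^2\|$ and $\|\nabla\log\pi_\theta(a\mid s)\|\le B_\Theta$. Let $\hat\nabla J(\theta),\check\nabla J(\theta),\tilde\nabla J(\theta)$ be the three stochastic policy gradients defined in the context. Then for any $\theta\in\mathbb R^d$ all three are unbiased estimates of $\nabla J(\theta)$: $$\mathbb E[\hat\nabla J(\theta)\mid\theta]=\mathbb E[\check\nabla J(\theta)\mid\theta]=\mathbb E[\tilde\nabla J(\theta)\mid\theta]=\nabla J(\theta),$$ where the expectation is over all the random horizons, the rollout trajectories, and the random sample $(s_T,a_T)$. Moreover, $\|\nabla J(\theta)\|\le \dfrac{B_\Theta U_R}{(1-\gamma)^2}$, and almost surely $\|\hat\nabla J(\theta)\|\le\hat\ell$, $\|\check\nabla J(\theta)\|\le\check\ell$, $\|\tilde\nabla J(\theta)\|\le\tilde\ell$, where $$\hat\ell=\frac{B_\Theta U_R}{(1-\gamma)(1-\gamma^{1/2})},\qquad \check\ell=\frac{2B_\Theta U_R}{(1-\gamma)(1-\gamma^{1/2})},\qquad \tilde\ell=\frac{(2+\gamma-\gamma^{1/2})B_\Theta U_R}{(1-\g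amma)(1-\gamma^{1/2})}.$$
   Context: A Markov decision process $(\mathcal S,\mathcal A,\mathbb P,R,\gamma)$ has state space $\mathcal S$ and action space $\mathcal A$ (each a finite set or a compact subset of a real vector space), transition kernel $\mathbb P(s'\mid s,a)$, deterministic reward $R:\mathcal S\times\mathcal A\to\mathbb R$ and discount factor $\gamma\in(0,1)$. For a policy $\pi$ (a map from states to probability distributions on $\mathcal A$), $V_\pi(s)=\mathbb E[\sum_{t\ge0}\gamma^tR(s_t,a_t)\mid s_0=s]$ and $Q_\pi(s,a)=\mathbb E[\sum_{t\ge0}\gamma^tR(s_t,a_t)\mid s_0=s,a_0=a]$, with $a_t\sim\pi(\cdot\mid s_t)$, $s_{t+1}\sim\mathbb P(\cdot\mid s_t,a_t)$. Policies are parameterized as $\pi_\theta$, $\theta\in\mathbb R^d$; the initial state $s_0$ is fixed and $J(\theta)=V_{\pi_\theta}(s_0)$. $\nabla$ is the gradient in $\theta$, $\|\cdot\|$ the Euclidean norm. $\mathrm{Geom}(1-q)$ denotes the law $P(T=t)=(1-q)q^t$, $t=0,1,2,\dots$. Estimators. Given $\theta$: draw $T\sim\mathrm{Geom}(1-\gamma)$, simulate a trajectory from $s_0$ with $a_t\sim\pi_\theta(\cdot\mid s_t)$, $s_{t+1}\sim\mathbb P(\cdot\mid s_t,a_t)$, and keep its last pair $(s_T,a_T)$. For a pair $(s,a)$, $\hat Q_{\pi_\theta}(s,a)=\sum_{t=0}^{T'}\gamma^{t/2}R(s_t,a_t)$ along a fresh trajectory under $\pi_\theta$ started at $s_0=s,a_0=a$,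 with $T'\sim\mathrm{Geom}(1-\gamma^{1/2})$ independent of everything else. For a state $s$, $\hat V_{\pi_\theta}(s)=\sum_{t=0}^{T'}\gamma^{t/2}R(s_t,a_t)$ along a fresh trajectory under $\pi_\theta$ started at $s_0=s$ with $a_0\sim\pi_\theta(\cdot\mid s)$, with its own independent $T'\sim\mathrm{Geom}(1-\gamma^{1/2})$. Different estimates use independent rollouts. With $s_T'\sim\mathbb P(\cdot\mid s_T,a_T)$, $$\hat\nabla J(\theta)=\tfrac1{1-\gamma}\hat Q_{\pi_\theta}(s_T,a_T)\nabla\log\pi_\theta(a_T\mid s_T),$$ $$\check\nabla J(\theta)=\tfrac1{1-\gamma}\big[\hat Q_{\pi_\theta}(s_T,a_T)-\hat V_{\pi_\theta}(s_T)\big]\nabla\log\pi_\theta(a_T\mid s_T),$$ $$\tilde\nabla J(\theta)=\tfrac1{1-\gamma}\big[R(s_T,a_T)+\gamma\hat V_{\pi_\theta}(s_T')-\hat V_{\pi_\theta}(s_T)\big]\nabla\log\pi_\theta(a_T\mid s_T).$$ *)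

(* Defs.v *)
From HB Require Import structures.
From mathcomp Require Import all_boot all_order all_algebra.
From mathcomp Require Import all_classical all_reals all_analysis.

Set Implicit Arguments.
Unset Strict Implicit.
Unset Printing Implicit Defensive.

Import Order.TTheory GRing.Theory Num.Theory.
Import numFieldNormedType.Exports.

Local Open Scope classical_set_scope.
Local Open Scope ring_scope.

(* The norm that the library puts on ['rV[R]_d] is the sup norm: it induces the
   right topology, but quantitative bounds need the Euclidean norm. *)
Definition enorm (R : realType) (d : nat) (v : 'rV[R]_d) : R :=
  Num.sqrt (\sum_(i < d) v ord0 i ^+ 2).

Definition gradient (R : realType) (d : nat) (f : 'rV[R]_d -> R)
    (theta : 'rV[R]_d) : 'rV[R]_d :=
  \row_(i < d) 'D_(delta_mx ord0 i) f theta.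

Definition score (R : realType) (d : nat) (S A : Type)
    (p : 'rV[R]_d -> S -> A -> R) (theta : 'rV[R]_d) (s : S) (a : A) :
    'rV[R]_d :=
  gradient (fun theta' => ln (p theta' s a)) theta.

(* Either a finite set with the discrete sigma-algebra, or (up to a bijection)
   a compact subset of a real normed space with its Borel sigma-algebra. *)
Definition finite_or_compact (R : realType) (dX : measure_display)
    (X : measurableType dX) : Prop :=
  (finite_set [set: X] /\ forall B : set X, measurable B) \/
  exists (E : normedModType R) (f : X -> E),
    [/\ injective f, compact (range f) &
        forall B : set X, measurable B <->
          exists2 C : set E, <<s [set U : set E | open U] >> C & B = f @^-1` C].

(* P(T = n) = (1 - q) q^n for n = 0, 1, 2, ... *)
Definition geometric_law (R : realType) (q : R) (B : set nat) : \bar R :=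
  (\esum_(n in B) ((1 - q) * q ^+ n)%:E)%E.

Section sampling.
Context {R : realType} {dO dS dA : measure_display}.
Context {Omega : measurableType dO}.
Context {S : measurableType dS} {A : measurableType dA}.
Implicit Types (P : probability Omega R) (G : set_system Omega).

Definition events_of (dX : measure_display) (X : measurableType dX)
    (x : Omega -> X) : set_system Omega :=
  preimage_set_system setT x measurable.

(* [x] is sampled from the (possibly random) law [mu]: conditionally on the
   sigma-algebra generated by [G], the law of [x] is [mu].  With a constant
   [mu], this says that [x] has law [mu] and is independent of [G]. *)
Definition drawn (dX : measure_display) (X : measurableType dX) P G
    (x : Omega -> X) (mu : Omega -> set X -> \bar R) : Prop :=
  measurable_fun setT x /\
  forall E B, <<s G >> E -> measurable B ->
    P (E `&` x @^-1` B) = (\int[P]_(w in E) mu w B)%E.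

Definition history (st : nat -> Omega -> S) (ac : nat -> Omega -> A) (n : nat) :
    set_system Omega :=
  \bigcup_(t < n) (events_of (st t) `|` events_of (ac t)).

Definition trajectory_events (st : nat -> Omega -> S)
    (ac : nat -> Omega -> A) : set_system Omega :=
  \bigcup_t (events_of (st t) `|` events_of (ac t)).

(* [G] is the information available before the trajectory is simulated. *)
Definition transitions P G (Ptr : R.-pker S * A ~> S) (pol : R.-pker S ~> A)
    (st : nat -> Omega -> S) (ac : nat -> Omega -> A) : Prop :=
  forall t,
    drawn P (G `|` history st ac t.+1) (st t.+1)
      (fun w => Ptr (st t w, ac t w)) /\
    drawn P (G `|` history st ac t.+1 `|` events_of (st t.+1)) (ac t.+1)
      (fun w => pol (st t.+1 w)).

Definition state_rollout P G (Ptr : R.-pker S * A ~> S) (pol : R.-pker S ~> A)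
    (x : Omega -> S) (st : nat -> Omega -> S) (ac : nat -> Omega -> A) : Prop :=
  [/\ measurable_fun setT (st 0%N),
      {ae P, forall w, st 0%N w = x w},
      drawn P (G `|` events_of (st 0%N)) (ac 0%N) (fun w => pol (st 0%N w)) &
      transitions P G Ptr pol st ac].

Definition pair_rollout P G (Ptr : R.-pker S * A ~> S) (pol : R.-pker S ~> A)
    (x : Omega -> S) (y : Omega -> A)
    (st : nat -> Omega -> S) (ac : nat -> Omega -> A) : Prop :=
  [/\ measurable_fun setT (st 0%N), measurable_fun setT (ac 0%N),
      {ae P, forall w, st 0%N w = x w /\ ac 0%N w = y w} &
      transitions P G Ptr pol st ac].

Definition discounted_return (gamma : R) (r : S * A -> R)
    (st : nat -> Omega -> S) (ac : nat -> Omega -> A) (w : Omega) : R :=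
  limn (series (fun t => gamma ^+ t * r (st t w, ac t w))).

(* The series converges and the expectation is finite when [r] is bounded and
   [0 < gamma < 1]. *)
Definition value P (gamma : R) (r : S * A -> R)
    (st : nat -> Omega -> S) (ac : nat -> Omega -> A) : R :=
  fine ('E_P[discounted_return gamma r st ac])%E.

Definition rollout_estimate (gamma : R) (r : S * A -> R) (T : Omega -> nat)
    (st : nat -> Omega -> S) (ac : nat -> Omega -> A) (w : Omega) : R :=
  \sum_(t < (T w).+1) Num.sqrt gamma ^+ t * r (st t w, ac t w).

Definition unbiased P (d : nat) (g : Omega -> 'rV[R]_d) (v : 'rV[R]_d) : Prop :=
  forall i : 'I_d,
    P.-integrable setT (EFin \o (fun w => g w ord0 i)) /\
    ('E_P[fun w => g w ord0 i] = (v ord0 i)%:E)%E.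

End sampling.

(* The random data used by the three estimators: the main trajectory with its
   horizon, the extra next state, and the rollouts (with their horizons) behind
   Qhat(s_T, a_T), Vhat(s_T) and Vhat(s_T'). *)
Record simulation (Omega S A : Type) := Simulation {
  hor : Omega -> nat; st : nat -> Omega -> S; ac : nat -> Omega -> A;
  nxt : Omega -> S;
  horQ : Omega -> nat; stQ : nat -> Omega -> S; acQ : nat -> Omega -> A;
  horV : Omega -> nat; stV : nat -> Omega -> S; acV : nat -> Omega -> A;
  horN : Omega -> nat; stN : nat -> Omega -> S; acN : nat -> Omega -> A }.

Section estimators.
Context {R : realType} {dO dS dA : measure_display}.
Context {Omega : measurableType dO}.
Context {S : measurableType dS} {A : measurableType dA}.
Implicit Types X : simulation Omega S A.

Definition last_state X (w : Omega) : S := st X (hor X w) w.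
Definition last_action X (w : Omega) : A := ac X (hor X w) w.

(* Everything simulated before each successive stage. *)
Definition known_horizons X : set_system Omega :=
  events_of (hor X) `|` events_of (horQ X) `|` events_of (horV X)
  `|` events_of (horN X).
Definition known_main X : set_system Omega :=
  known_horizons X `|` trajectory_events (st X) (ac X).
Definition known_next X : set_system Omega :=
  known_main X `|` events_of (nxt X).
Definition known_Q X : set_system Omega :=
  known_next X `|` trajectory_events (stQ X) (acQ X).
Definition known_V X : set_system Omega :=
  known_Q X `|` trajectory_events (stV X) (acV X).

(* The main trajectory is simulated without end, independently of its horizon
   [hor X]; only its pair at time [hor X] is used. *)
Record simulated (P : probability Omega R) (gamma : R)
    (Ptr : R.-pker S * A ~> S) (pol : R.-pker S ~> A) (s0 : S) X : Prop := {
  horP : drawn P set0 (hor X) (fun=> geometric_law gamma);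
  horQP : drawn P (events_of (hor X)) (horQ X)
    (fun=> geometric_law (Num.sqrt gamma));
  horVP : drawn P (events_of (hor X) `|` events_of (horQ X)) (horV X)
    (fun=> geometric_law (Num.sqrt gamma));
  horNP : drawn P
    (events_of (hor X) `|` events_of (horQ X) `|` events_of (horV X)) (horN X)
    (fun=> geometric_law (Num.sqrt gamma));
  mainP : state_rollout P (known_horizons X) Ptr pol (cst s0) (st X) (ac X);
  nextP : drawn P (known_main X) (nxt X)
    (fun w => Ptr (last_state X w, last_action X w));
  rollQP : pair_rollout P (known_next X) Ptr pol
    (last_state X) (last_action X) (stQ X) (acQ X);
  rollVP : state_rollout P (known_Q X) Ptr pol (last_state X) (stV X) (acV X);
  rollNP : state_rollout P (known_V X) Ptr pol (nxt X) (stN X) (acN X) }.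

Variables (d : nat) (gamma : R) (r : S * A -> R).
Variables (p : 'rV[R]_d -> S -> A -> R) (theta : 'rV[R]_d).

Definition Qhat X : Omega -> R :=
  rollout_estimate gamma r (horQ X) (stQ X) (acQ X).
Definition Vhat X : Omega -> R :=
  rollout_estimate gamma r (horV X) (stV X) (acV X).
Definition Vhat_next X : Omega -> R :=
  rollout_estimate gamma r (horN X) (stN X) (acN X).

Definition grad_hat X (w : Omega) : 'rV[R]_d :=
  ((1 - gamma)^-1 * Qhat X w)
    *: score p theta (last_state X w) (last_action X w).

Definition grad_check X (w : Omega) : 'rV[R]_d :=
  ((1 - gamma)^-1 * (Qhat X w - Vhat X w))
    *: score p theta (last_state X w) (last_action X w).

Definition grad_tilde X (w : Omega) : 'rV[R]_d :=
  ((1 - gamma)^-1 * (r (last_state X w, last_action X w)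
                     + gamma * Vhat_next X w - Vhat X w))
    *: score p theta (last_state X w) (last_action X w).

End estimators.

(* Main.v *)
Require Import Defs.
From HB Require Import structures.
From mathcomp Require Import all_boot all_order all_algebra.
From mathcomp Require Import all_classical all_reals all_analysis.
From mathcomp Require Import measurable_realfun ring lra.
Set Implicit Arguments.
Unset Strict Implicit.
Unset Printing Implicit Defensive.
Import Order.TTheory GRing.Theory Num.Theory.
Import numFieldNormedType.Exports.
Local Open Scope classical_set_scope.
Local Open Scope ring_scope.

(** Let [K] be the state-action transition operator of [pi_theta], and
    [pot f = sum_t gamma^t K^t f], so that [Q = pot r] is the action value.
    If [w] is the likelihood ratio of [pi_theta'] to [pi_theta], the two Bellman
    equations give [E = (w - 1) Q' + gamma K E] for [E = w Q' - Q], and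
    [J theta' - J theta] is the mean of [E (s0, .)] under [pi_theta].  The
    Lipschitz score gives [w - 1 = <score, h> + O(|h|^2)] uniformly in the pair,
    and [gamma K] is a contraction, so that [J theta' - J theta] equals
    [<D, h> + O(|h|^2)], where [D] is the mean of [pot (score * Q) (s0, .)]:
    no limit has to be exchanged with an integral.

    For the estimators, a geometric horizon of parameter [q] exceeds [t] with
    probability [q ^ t].  The horizon of the main trajectory thus turns
    [E (Phi (s_T, a_T))] into [(1 - gamma)] times the mean of [pot Phi (s0, .)],
    and the weights [gamma^(t/2)] of a rollout are completed to [gamma ^ t] by the
    survival probabilities of its own horizon.  The baseline drops out because
    the score has mean zero under the policy. *)

(** * Bounded measurable functions *)

Section bounded_measurable.
Context {R : realType} {d : measure_display} {T : measurableType d}.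
Implicit Types f g : T -> R.

(** The law of a trajectory depends on [theta] through infinitely many draws, so differentiating [J]
    directly would mean differentiating under infinitely many nested integrals. Comparing fixed
    point equations instead involves the two policies only through one-step averages, related by a
    bounded likelihood ratio. The unknown is [w Q' - Q] rather than [Q' - Q] because the mean of
    [Q'] under the shifted policy is the mean of [w Q'] under the original one. Its source
    [(w - 1) Q'] still contains [Q']; replacing it by [Q] costs [(w - 1) (Q' - Q)], and this is
    quadratic because [Q' - Q] is itself of first order. On the probabilistic side a draw is
    specified only by its probabilities on past events. A monotone class argument carries these
    identities to bounded functions, and since every reward, score and weight is bounded, each
    exchange of a sum with an integral is an instance of bounded convergence. *)

Definition bounded_measurable f : Prop :=
  measurable_fun setT f /\ exists C, forall x, `|f x| <= C.

Lemma bounded_measurable_ge0 f : bounded_measurable f ->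
  exists2 C, 0 <= C & forall x, `|f x| <= C.
Proof.
move=> [_ [C fC]]; exists `|C| => // x.
exact: le_trans (fC x) (ler_norm C).
Qed.

Lemma bounded_measurable_cst c : bounded_measurable (cst c).
Proof. by split => //; exists `|c|. Qed.

Lemma bounded_measurableD f g : bounded_measurable f -> bounded_measurable g ->
  bounded_measurable (fun x => f x + g x).
Proof.
move=> [mf [C fC]] [mg [D gD]]; split; first exact: measurable_funD.
by exists (C + D) => x; rewrite (le_trans (ler_normD _ _))// lerD.
Qed.

Lemma bounded_measurableM f g : bounded_measurable f -> bounded_measurable g ->
  bounded_measurable (fun x => f x * g x).
Proof.
move=> [mf [C fC]] [mg [D gD]]; split; first exact: measurable_funM.
by exists (C * D) => x; rewrite normrM ler_pM.
Qed.

Lemma bounded_measurableZ a f : bounded_measurable f ->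
  bounded_measurable (fun x => a * f x).
Proof. exact: bounded_measurableM (bounded_measurable_cst a). Qed.

Lemma bounded_measurableB f g : bounded_measurable f -> bounded_measurable g ->
  bounded_measurable (fun x => f x - g x).
Proof.
move=> bf bg; under eq_fun do rewrite -mulN1r.
exact: bounded_measurableD bf (bounded_measurableZ _ bg).
Qed.

Lemma bounded_measurable_sum n (F : 'I_n -> T -> R) :
  (forall i, bounded_measurable (F i)) ->
  bounded_measurable (fun x => \sum_(i < n) F i x).
Proof.
elim: n F => [|n IH] F bF.
  by under eq_fun do rewrite big_ord0; exact: bounded_measurable_cst.
under eq_fun do rewrite big_ord_recr /=.
apply: bounded_measurableD => //.
exact: (IH (fun i => F (widen_ord (leqnSn n) i))).
Qed.

Lemma bounded_measurable_indic (B : set T) : measurable B ->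
  bounded_measurable (\1_B).
Proof.
move=> mB; split; first exact: measurable_indic.
by exists 1 => x; rewrite indicE; case: (_ \in _); rewrite ?normr1 ?normr0.
Qed.

Lemma bounded_measurable_lim (f_ : (T -> R)^nat) f C :
  (forall n, measurable_fun setT (f_ n)) -> (forall n x, `|f_ n x| <= C) ->
  (forall x, f_ ^~ x @ \oo --> f x) -> bounded_measurable f.
Proof.
move=> mf fC ff; split.
  by apply: (measurable_fun_cvg mf) => x _; exact: ff.
exists C => x; have /cvg_lim <- // : `|f_ n x| @[n --> \oo] --> `|f x|.
  by apply: cvg_norm; exact: ff.
apply: limr_le; first by apply/cvg_ex; eexists; apply: cvg_norm; exact: ff.
by apply: nearW => n; exact: fC.
Qed.

End bounded_measurable.

Lemma bounded_measurable_comp {R : realType} d1 d2 (T1 : measurableType d1)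
    (T2 : measurableType d2) (f : T2 -> R) (u : T1 -> T2) :
  bounded_measurable f -> measurable_fun setT u ->
  bounded_measurable (f \o u).
Proof.
move=> [mf [C fC]] mu; split; first exact: measurableT_comp.
by exists C => x; exact: fC.
Qed.

Section bounded_monotone_class.
Import HBSimple HBNNSimple.

(** Dynkin induction gives the indicators of all measurable sets, linearity gives simple functions,
    and bounded limits give the rest. Closure is required under bounded pointwise limits, not only
    monotone ones, since this is the form in which integrals pass to the limit later. *)
Lemma bounded_monotone_class {R : realType} d (T : measurableType d)
    (G : set_system T) (H : set (T -> R)) :
  @measurable _ T = <<s G >> -> setI_closed G ->
  H (cst 1) -> (forall B, G B -> H (\1_B)) ->
  (forall a f g, bounded_measurable f -> bounded_measurable g ->
     H f -> H g -> H (fun x => a * f x + g x)) ->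
  (forall (f_ : (T -> R)^nat) f C, (forall n, bounded_measurable (f_ n)) ->
     (forall n x, `|f_ n x| <= C) -> (forall x, f_ ^~ x @ \oo --> f x) ->
     (forall n, H (f_ n)) -> H f) ->
  forall f, bounded_measurable f -> H f.
Proof.
move=> GE GI H1 HG Hlin Hlim f bf.
have H0 : H (cst 0).
  have := Hlin (-1) (cst 1) (cst 1) (bounded_measurable_cst _)
    (bounded_measurable_cst _) H1 H1.
  by congr (H _); apply/funext => x /=; rewrite mulN1r addNr.
have HB (B : set T) : measurable B -> H (\1_B).
  rewrite {1}GE; move: B; apply: dynkin_induction => //.
  - by rewrite indicT.
  - move=> B mB HB.
    have := Hlin (-1) _ _ (bounded_measurable_indic mB)
      (bounded_measurable_cst 1) HB H1.
    congr (H _); apply/funext => x /=; rewrite indicC /= !indicE.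
    by case: (_ \in _); rewrite ?mulr1 ?mulr0 ?add0r ?addNr.
  - move=> F mF tF HF.
    (* The indicator of the union is the bounded limit of those of the finite unions; disjointness
       makes each of these a sum. *)
    pose U n := \big[setU/set0]_(k < n) F k.
    have mU n : measurable (U n) by apply: bigsetU_measurable => i _.
    apply: (Hlim (fun n => \1_(U n)) _ 1).
    + by move=> n; exact: bounded_measurable_indic.
    + by move=> n x; rewrite indicE; case: (_ \in _); rewrite ?normr1 ?normr0.
    + move=> x; have [[k _ Fkx]|nFx] := pselect ((\bigcup_k F k) x).
        apply: cvg_near_cst; near=> n; rewrite !indicE.
        have Ux : U n x.
          rewrite /U -bigcup_mkord; exists k => //=.
          by near: n; exact: nbhs_infty_gt.
        by rewrite !mem_set//; exists k.
      apply: cvg_near_cst; near=> n; rewrite !indicE !memNset //.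
      rewrite /U -bigcup_mkord => -[k _ Fkx]; apply: nFx.
      by exists k.
    + elim=> [|n IH]; first by rewrite /U big_ord0 indic0.
      have := Hlin 1 _ _ (bounded_measurable_indic (mU n))
        (bounded_measurable_indic (mF n)) IH (HF n).
      congr (H _); apply/funext => x; rewrite mul1r /U big_ord_recr /= -/(U n).
      rewrite !indicE in_setU.
      have [|] := boolP (x \in U n) => /=; last by rewrite add0r.
      rewrite inE /U -bigcup_mkord => -[k /= kn Fkx].
      rewrite memNset ?addr0// => Fnx.
      have kE := tF k n I I (ex_intro _ x (conj Fkx Fnx)).
      by rewrite kE ltnn in kn.
have [C C0 fC] := bounded_measurable_ge0 bf.
(* The shift makes the function nonnegative, so that it has simple approximations from below, all
   under one bound. *)
pose g x := f x + C.
have bg : bounded_measurable g.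
  by apply: bounded_measurableD => //; exact: bounded_measurable_cst.
suff Hg : H g.
  have := Hlin (- C) (cst 1) g (bounded_measurable_cst _) bg H1 Hg.
  by congr (H _); apply/funext => x; rewrite /g /=; ring.
have g0 x : (0 <= (g x)%:E)%E.
  by rewrite lee_fin /g; have := fC x; rewrite ler_norml => /andP[]; lra.
have mg : measurable_fun [set: T] (EFin \o g).
  by apply/measurable_EFinP; exact: bg.1.
pose g_ := nnsfun_approx measurableT mg.
have g_cvg x : (g_ ^~ x : R^nat) @ \oo --> g x.
  have := cvg_nnsfun_approx measurableT mg (fun x _ => g0 x) (I : setT x).
  exact: fine_cvg.
have g_le n x : g_ n x <= g x.
  have /cvg_lim <- // := g_cvg x.
  apply: nondecreasing_cvgn_le; last by apply/cvg_ex; eexists; exact: g_cvg.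
  by move=> m1 m2 m12; have /lefP := nd_nnsfun_approx measurableT mg m12; apply.
have [D D0 gD] := bounded_measurable_ge0 bg.
have g_D n x : `|g_ n x| <= D.
  rewrite ger0_norm//.
  by rewrite (le_trans (g_le n x))// (le_trans _ (gD x))// ler_norm.
apply: (Hlim (fun n => g_ n : T -> R) g D _ g_D g_cvg).
  by move=> n; split => //; exists D.
move=> n.
have [m [a [B [mB gE]]]] : exists m (a : nat -> R) (B : nat -> set T),
    (forall i, measurable (B i)) /\
    (g_ n : T -> R) = fun x => \sum_(i < m) (a i * \1_(B i) x).
  pose s : seq R := finmap.enum_fset (fset_set (g_ n @` setT)).
  exists (size s), (fun i => s`_i), (fun i => g_ n @^-1` [set s`_i]).
  by split => //; apply/funext => x; exact: fimfunEord.
rewrite {}gE; elim: m => [|m IH].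
  by under eq_fun do rewrite big_ord0.
under eq_fun do rewrite big_ord_recr /= addrC.
apply: Hlin => //.
- exact: bounded_measurable_indic.
- apply: bounded_measurable_sum => i; apply: bounded_measurableZ.
  exact: bounded_measurable_indic.
- exact: HB.
Unshelve. all: by end_near.
Qed.

End bounded_monotone_class.

(** * Integrals of bounded functions *)

Section bounded_integral.
Context {R : realType} {d : measure_display} {T : measurableType d}.
Variable mu : {measure set T -> \bar R}.
Hypothesis mu1 : mu setT = 1%E.
Implicit Types f g : T -> R.

Lemma bounded_measurable_integrable f : bounded_measurable f ->
  mu.-integrable setT (EFin \o f).
Proof.
move=> [mf [C fC]]; apply: measurable_bounded_integrable => //.
  by rewrite /= mu1 ltry.
exists C; split; first exact: num_real.
by move=> y /ltW Cy x _; exact: le_trans (fC x) Cy.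
Qed.

Lemma bint_cst c : \int[mu]_x c = c.
Proof. by rewrite Rintegral_cst//= mu1 mulr1. Qed.

Lemma bintD f g : bounded_measurable f -> bounded_measurable g ->
  \int[mu]_x (f x + g x) = \int[mu]_x f x + \int[mu]_x g x.
Proof. by move=> bf bg; rewrite RintegralD//; exact: bounded_measurable_integrable. Qed.

Lemma bintZ a f : bounded_measurable f ->
  \int[mu]_x (a * f x) = a * \int[mu]_x f x.
Proof. by move=> bf; rewrite RintegralZl//; exact: bounded_measurable_integrable. Qed.

Lemma bint_le f g : bounded_measurable f -> bounded_measurable g ->
  (forall x, f x <= g x) -> \int[mu]_x f x <= \int[mu]_x g x.
Proof.
by move=> bf bg fg; apply: le_Rintegral => //; exact: bounded_measurable_integrable.
Qed.

Lemma bint_norm_le C f : bounded_measurable f -> (forall x, `|f x| <= C) ->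
  `|\int[mu]_x f x| <= C.
Proof.
move=> bf fC; rewrite -[C]bint_cst ler_norml -[- \int[_]_ _ _]mulN1r -bintZ//;
  last exact: bounded_measurable_cst.
apply/andP; split; apply: bint_le => //.
- by apply: bounded_measurableZ; exact: bounded_measurable_cst.
- by move=> x; rewrite mulN1r; have := fC x; rewrite ler_norml => /andP[].
- exact: bounded_measurable_cst.
- by move=> x; rewrite (le_trans _ (fC x))// ler_norm.
Qed.

Lemma bint_cvg (f_ : (T -> R)^nat) f C :
  (forall n, measurable_fun setT (f_ n)) -> (forall n x, `|f_ n x| <= C) ->
  (forall x, f_ ^~ x @ \oo --> f x) ->
  \int[mu]_x f_ n x @[n --> \oo] --> \int[mu]_x f x.
Proof.
move=> mf fC ff; have bf := bounded_measurable_lim mf fC ff.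
have bC := bounded_measurable_integrable (bounded_measurable_cst C).
have [] := @dominated_convergence _ _ _ mu _ measurableT (fun n => EFin \o f_ n)
  (EFin \o f) (EFin \o cst C).
- by move=> n; apply/measurable_EFinP; exact: mf.
- by apply/measurable_EFinP; exact: bf.1.
- by apply: aeW => x _; apply: cvg_EFin; [exact: nearW|exact: ff].
- exact: bC.
- by apply: aeW => x n _; rewrite lee_fin; exact: fC.
move=> intf _; rewrite /Rintegral -[X in _ --> X -> _]fineK//.
  exact: fine_cvg.
exact: integrable_fin_num.
Qed.

Lemma bint_indic (B : set T) : measurable B -> \int[mu]_x \1_B x = fine (mu B).
Proof. by move=> mB; rewrite /Rintegral integral_indic// setIT. Qed.

Lemma bint_ae_eq f g : measurable_fun setT f -> measurable_fun setT g ->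
  {ae mu, forall x, f x = g x} -> \int[mu]_x f x = \int[mu]_x g x.
Proof.
move=> mf mg fg; rewrite /Rintegral; congr fine; apply: ae_eq_integral => //.
- exact/measurable_EFinP.
- exact/measurable_EFinP.
- by apply: filterS fg => x /= -> _.
Qed.

End bounded_integral.

(* The properties of integration against a probability measure that are used;
   unlike measures, such functionals compose with transition operators without
   any further construction. *)
Record mean {R : realType} {d} {T : measurableType d} (L : (T -> R) -> R) : Prop :=
  Mean {
  meanD : forall f g, bounded_measurable f -> bounded_measurable g ->
    L (fun x => f x + g x) = L f + L g;
  meanZ : forall a f, bounded_measurable f -> L (fun x => a * f x) = a * L f;
  mean_norm_le : forall C f, bounded_measurable f -> (forall x, `|f x| <= C) ->
    `|L f| <= C;
  mean_cvg : forall (f_ : (T -> R)^nat) f C,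
    (forall n, bounded_measurable (f_ n)) -> (forall n x, `|f_ n x| <= C) ->
    (forall x, f_ ^~ x @ \oo --> f x) -> L (f_ n) @[n --> \oo] --> L f }.

Section mean_lemmas.
Context {R : realType} {d : measure_display} {T : measurableType d}.
Variables (L : (T -> R) -> R) (mL : mean L).

Lemma meanB f g : bounded_measurable f -> bounded_measurable g ->
  L (fun x => f x - g x) = L f - L g.
Proof.
move=> bf bg; rewrite -[in RHS](mulN1r (L g)) -(meanZ mL)// -(meanD mL)//.
  by congr L; apply/funext => x; rewrite mulN1r.
exact: bounded_measurableZ.
Qed.

Lemma mean0 : L (cst 0) = 0.
Proof.
have b0 : bounded_measurable (cst 0 : T -> R) by exact: bounded_measurable_cst.
by apply/eqP; rewrite -normr_le0; apply: (mean_norm_le mL) => // x; rewrite normr0.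
Qed.

Lemma mean_sum n (F : 'I_n -> T -> R) : (forall i, bounded_measurable (F i)) ->
  L (fun x => \sum_(i < n) F i x) = \sum_(i < n) L (F i).
Proof.
elim: n F => [|n IH] F bF.
  rewrite big_ord0 -[RHS]mean0; congr L.
  by apply/funext => x; rewrite big_ord0.
rewrite big_ord_recr /= -IH// -(meanD mL)//; last exact: bounded_measurable_sum.
by congr L; apply/funext => x; rewrite big_ord_recr.
Qed.

End mean_lemmas.

Lemma mean_bint {R : realType} d (T : measurableType d)
    (mu : {measure set T -> \bar R}) : mu setT = 1%E -> mean (fun f => \int[mu]_x f x).
Proof.
move=> mu1; split.
- by move=> f g; exact: bintD.
- by move=> a f; exact: bintZ.
- by move=> C f; exact: bint_norm_le.
- by move=> f_ f C bf; apply: bint_cvg => // n; exact: (bf n).1.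
Qed.

Lemma mean_comp {R : realType} d d' (X : measurableType d) (Y : measurableType d')
    (L : (X -> R) -> R) (M : (Y -> R) -> X -> R) :
  mean L -> (forall x, mean (fun f => M f x)) ->
  (forall f, bounded_measurable f -> bounded_measurable (M f)) ->
  mean (fun f => L (M f)).
Proof.
move=> mL mM bM; split.
- move=> f g bf bg; rewrite -(meanD mL); [|exact: bM..].
  by congr L; apply/funext => x; exact: (meanD (mM x)).
- move=> a f bf; rewrite -(meanZ mL); [|exact: bM].
  by congr L; apply/funext => x; exact: (meanZ (mM x)).
- move=> C f bf fC; apply: (mean_norm_le mL); first exact: bM.
  by move=> x; exact: (mean_norm_le (mM x)).
- move=> f_ f C bf fC ff; apply: (mean_cvg mL (C := C)).
  + by move=> n; exact: bM.
  + by move=> n x; exact: (mean_norm_le (mM x)).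
  + by move=> x; exact: (mean_cvg (mM x) bf fC ff).
Qed.

Lemma mean_precomp {R : realType} d d' (X : measurableType d) (Y : measurableType d')
    (L : (X -> R) -> R) (u : X -> Y) :
  mean L -> measurable_fun setT u -> mean (fun f => L (f \o u)).
Proof.
move=> mL mu; apply: (mean_comp (M := fun f => f \o u)) => //.
- by move=> x; split => //=.
- by move=> f bf; exact: bounded_measurable_comp.
Qed.

Section kernel_integral.
Context {R : realType} {d d' : measure_display}.
Context {X : measurableType d} {Y : measurableType d'}.
Variable k : R.-pker X ~> Y.
Implicit Types f g : X * Y -> R.

(** The integrand sees the source of the kernel as well as its target; with a policy as kernel this
    turns an action value into a state value. *)
Definition kint f (x : X) : R := \int[k x]_y f (x, y).

Lemma bounded_measurable_section f x : bounded_measurable f ->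
  bounded_measurable (fun y => f (x, y)).
Proof. by move=> bf; apply: (bounded_measurable_comp bf); exact: pair1_measurable. Qed.

Lemma mean_kint x : mean (fun f => kint f x).
Proof.
have mk : mean (fun g : Y -> R => \int[k x]_y g y) by apply: mean_bint; exact: prob_kernel.
exact: (mean_precomp mk (pair1_measurable x)).
Qed.

Lemma kint_indicX (B : set X) (C : set Y) x : measurable C ->
  kint (\1_(B `*` C)) x = \1_B x * fine (k x C).
Proof.
move=> mC; rewrite -bint_indic// -bintZ;
  [|exact: prob_kernel|exact: bounded_measurable_indic].
by apply: eq_Rintegral => y _; rewrite !indicE in_setX -mulnb natrM.
Qed.

End kernel_integral.

Lemma setI_closed_rectangles d d' (X : measurableType d) (Y : measurableType d') :
  setI_closed [set B `*` C | B in @measurable _ X & C in @measurable _ Y].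
Proof.
move=> _ _ [A1 mA1 [A2 mA2 <-]] [B1 mB1 [B2 mB2 <-]].
exists (A1 `&` B1); first exact: measurableI.
exists (A2 `&` B2); first exact: measurableI.
by rewrite setXI.
Qed.

Lemma bounded_monotone_class_prod {R : realType} d d' (X : measurableType d)
    (Y : measurableType d') (H : set (X * Y -> R)) :
  (forall B C, measurable B -> measurable C -> H (\1_(B `*` C))) ->
  (forall a f g, bounded_measurable f -> bounded_measurable g ->
     H f -> H g -> H (fun x => a * f x + g x)) ->
  (forall (f_ : (X * Y -> R)^nat) f C, (forall n, bounded_measurable (f_ n)) ->
     (forall n x, `|f_ n x| <= C) -> (forall x, f_ ^~ x @ \oo --> f x) ->
     (forall n, H (f_ n)) -> H f) ->
  forall f, bounded_measurable f -> H f.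
Proof.
move=> HX; apply: bounded_monotone_class.
- exact: measurable_prod_measurableType.
- exact: setI_closed_rectangles.
- by have := HX _ _ measurableT measurableT; rewrite setXTT indicT.
- by move=> _ [B mB [C mC <-]]; exact: HX.
Qed.

(** On a rectangle the integral is an indicator times a kernel mass, measurable by the definition of
    a kernel; the monotone class does the rest. *)
Lemma bounded_measurable_kint {R : realType} d d' (X : measurableType d)
    (Y : measurableType d') (k : R.-pker X ~> Y) (f : X * Y -> R) :
  bounded_measurable f -> bounded_measurable (kint k f).
Proof.
move: f; apply: bounded_monotone_class_prod.
- move=> B C mB mC; rewrite (_ : kint _ _ = fun x => \1_B x * fine (k x C)); last first.
    by apply/funext => x; rewrite kint_indicX.
  apply: bounded_measurableM; first exact: bounded_measurable_indic.
  split; first by apply: measurableT_comp => //; exact: measurable_kernel.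
  exists 1 => x; have kC : (k x C <= 1)%E.
    by rewrite -(prob_kernel (s := k) x) le_measure ?inE.
  rewrite ger0_norm ?fine_ge0// -lee_fin fineK//.
  by rewrite ge0_fin_numE// (le_lt_trans kC)// ltry.
- move=> a f g bf bg Hf Hg.
  rewrite (_ : kint _ _ = fun x => a * kint k f x + kint k g x); last first.
    apply/funext => x; rewrite (meanD (mean_kint k x))// ?(meanZ (mean_kint k x))//.
    exact: bounded_measurableZ.
  by apply: bounded_measurableD => //; exact: bounded_measurableZ.
- move=> f_ f C bf fC ff Hf.
  apply: (@bounded_measurable_lim _ _ _ (fun n => kint k (f_ n)) _ C).
  + by move=> n; have [] := Hf n.
  + by move=> n x; exact: (mean_norm_le (mean_kint k x)).
  + by move=> x; exact: (mean_cvg (mean_kint k x) bf fC).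
Qed.

(** * Discounted sums and transition operators *)

Section discounted_sum.
Context {R : realType} (q : R).
Hypotheses (q0 : 0 <= q) (q1 : q < 1).
Implicit Types u : R^nat.

(** The ratio is left free: it is [gamma] for the values and [Num.sqrt gamma] for the rollout
    estimates. *)
Definition dsum u : R := limn (series (fun t => q ^+ t * u t)).

Lemma geometric_partial_sum_le n : \sum_(0 <= t < n) q ^+ t <= (1 - q)^-1.
Proof.
rewrite -[leRHS]mul1r; have [q_gt0|] := ltP 0 q.
  have := geometric_le_lim n ler01 q_gt0; rewrite ger0_norm// => /(_ q1).
  apply: le_trans; rewrite /series /=; apply: ler_sum => i _.
  by rewrite mul1r.
(* The geometric bound used above asks for a positive ratio; here only the term of exponent zero
   survives. *)
move=> qle0; have -> : q = 0 by apply/eqP; rewrite eq_le qle0.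
rewrite subr0 invr1 mulr1; case: n => [|n]; first by rewrite big_geq.
rewrite big_nat_recl//= expr0 big1 ?addr0// => i _.
by rewrite expr0n.
Qed.

Lemma dsum_partial_norm_le C u n : (forall t, `|u t| <= C) ->
  `|series (fun t => q ^+ t * u t) n| <= C / (1 - q).
Proof.
move=> uC; have C0 : 0 <= C := le_trans (normr_ge0 _) (uC 0%N).
rewrite (le_trans (ler_norm_sum _ _ _))//.
rewrite (@le_trans _ _ (\sum_(0 <= t < n) C * q ^+ t))//.
  apply: ler_sum => t _; rewrite normrM ger0_norm ?exprn_ge0// mulrC.
  by rewrite ler_wpM2r// exprn_ge0.
by rewrite -mulr_sumr ler_wpM2l// geometric_partial_sum_le.
Qed.

Lemma dsum_cvg C u : (forall t, `|u t| <= C) ->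
  series (fun t => q ^+ t * u t) @ \oo --> dsum u.
Proof.
move=> uC; apply: normed_cvg.
have C0 : 0 <= C := le_trans (normr_ge0 _) (uC 0%N).
apply: (@series_le_cvg _ _ (geometric C q)).
- by move=> n; rewrite normr_ge0.
- by move=> n; rewrite /= mulr_ge0// exprn_ge0.
- move=> n /=; rewrite normrM ger0_norm ?exprn_ge0// mulrC.
  by rewrite ler_wpM2r// exprn_ge0.
- by apply: is_cvg_geometric_series; rewrite ger0_norm.
Qed.

Lemma dsum_norm_le C u : (forall t, `|u t| <= C) -> `|dsum u| <= C / (1 - q).
Proof.
move=> uC; have /cvg_norm uc := dsum_cvg uC.
rewrite -(cvg_lim (@Rhausdorff R) uc); apply: limr_le.
  by apply/cvg_ex; eexists; exact: uc.
by apply: nearW => n; exact: dsum_partial_norm_le.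
Qed.

Lemma dsum_recl C u : (forall t, `|u t| <= C) ->
  dsum u = u 0%N + q * dsum (fun t => u t.+1).
Proof.
move=> uC; apply: (cvg_unique (@Rhausdorff R) (dsum_cvg uC)).
suff : [sequence series (fun t => q ^+ t * u t) n.+1]_n @ \oo -->
    u 0%N + q * dsum (fun t => u t.+1) by rewrite cvg_shiftS.
rewrite (_ : [sequence _]_n = fun n => u 0%N + q * series (fun t => q ^+ t * u t.+1) n).
  apply: cvgD; first exact: cvg_cst.
  by apply: cvgMl_tmp; apply: dsum_cvg => t; exact: uC.
apply/funext => n; rewrite /= /series/= big_nat_recl//= expr0 mul1r; congr (_ + _).
by rewrite mulr_sumr; apply: eq_bigr => t _; rewrite exprS mulrA.
Qed.

Lemma bounded_measurable_dsum {d} {T : measurableType d} C (u : nat -> T -> R) :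
  (forall t, bounded_measurable (u t)) -> (forall t x, `|u t x| <= C) ->
  bounded_measurable (fun x => dsum (u ^~ x)).
Proof.
move=> bu uC.
apply: (@bounded_measurable_lim _ _ _
    (fun n x => series (fun t => q ^+ t * u t x) n) _ (C / (1 - q))).
- move=> n; under eq_fun do rewrite /series /= big_mkord.
  by apply: (bounded_measurable_sum (F := fun (i : 'I_n) x => q ^+ i * u i x) _).1
    => i; exact: bounded_measurableZ.
- by move=> n x; exact: dsum_partial_norm_le.
- by move=> x; exact: (@dsum_cvg C).
Qed.

Lemma mean_dsum_partial {d} {T : measurableType d} (L : (T -> R) -> R)
    (u : nat -> T -> R) n : mean L -> (forall t, bounded_measurable (u t)) ->
  L (fun x => series (fun t => q ^+ t * u t x) n) =
  series (fun t => q ^+ t * L (u t)) n.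
Proof.
move=> mL bu; rewrite /series /= big_mkord.
under eq_fun do rewrite big_mkord.
rewrite (mean_sum mL (F := fun (i : 'I_n) x => q ^+ i * u i x)).
  by apply: eq_bigr => i _; rewrite (meanZ mL).
by move=> i; exact: bounded_measurableZ.
Qed.

(** The partial sums are all bounded by [C / (1 - q)], so the continuity of [L] along bounded
    sequences exchanges it with the series. *)
Lemma mean_dsum {d} {T : measurableType d} C (L : (T -> R) -> R) (u : nat -> T -> R) :
  mean L -> (forall t, bounded_measurable (u t)) -> (forall t x, `|u t x| <= C) ->
  L (fun x => dsum (u ^~ x)) = dsum (fun t => L (u t)).
Proof.
move=> mL bu uC.
have Lu : forall t, `|L (u t)| <= C by move=> t; exact: (mean_norm_le mL).
apply/esym/(cvg_unique (@Rhausdorff R) (dsum_cvg Lu)).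
rewrite (_ : series _ = fun n => L (fun x => series (fun t => q ^+ t * u t x) n));
  last by apply/funext => n; rewrite mean_dsum_partial.
apply: (mean_cvg mL (C := C / (1 - q))).
- move=> n; under eq_fun do rewrite /series /= big_mkord.
  apply: (bounded_measurable_sum (F := fun (i : 'I_n) x => q ^+ i * u i x)) => i.
  exact: bounded_measurableZ.
- by move=> n x; exact: dsum_partial_norm_le.
- by move=> x; exact: (@dsum_cvg C).
Qed.

End discounted_sum.

Section policy_operators.
Context {R : realType} {dS dA : measure_display}.
Context {S : measurableType dS} {A : measurableType dA}.
Variables (gamma : R) (Ptr : R.-pker S * A ~> S) (pol : R.-pker S ~> A).
Hypotheses (gamma0 : 0 <= gamma) (gamma1 : gamma < 1).
Implicit Types f g u : S * A -> R.

(** [kint Ptr] integrates functions of the old pair and the new state; composing with [snd] forgets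
    the old pair. *)
Definition step f : S * A -> R := kint Ptr (kint pol f \o snd).

Lemma bounded_measurable_step f : bounded_measurable f -> bounded_measurable (step f).
Proof.
move=> bf; apply: bounded_measurable_kint; apply: bounded_measurable_comp => //.
exact: bounded_measurable_kint.
Qed.

Lemma mean_step x : mean (fun f => step f x).
Proof.
apply: (mean_comp (M := kint pol) (mean_precomp (mean_kint Ptr x) measurable_snd)).
- by move=> s; exact: mean_kint.
- exact: bounded_measurable_kint.
Qed.

Lemma bounded_measurable_iter_step t f : bounded_measurable f ->
  bounded_measurable (iter t step f).
Proof. by move=> bf; elim: t => [//|t IH]; exact: bounded_measurable_step. Qed.

Lemma mean_iter_step t x : mean (fun f => iter t step f x).
Proof.
elim: t x => [|t IH] x; first by split => //=.
apply: (mean_comp (M := iter t step) (mean_step x)) => //.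
exact: bounded_measurable_iter_step.
Qed.

Definition potential f (x : S * A) : R := dsum gamma (fun t => iter t step f x).

Lemma iter_step_norm_le C f t x : bounded_measurable f -> (forall z, `|f z| <= C) ->
  `|iter t step f x| <= C.
Proof. by move=> bf fC; exact: (mean_norm_le (mean_iter_step t x)). Qed.

Lemma bounded_measurable_potential f : bounded_measurable f ->
  bounded_measurable (potential f).
Proof.
move=> bf; have [C C0 fC] := bounded_measurable_ge0 bf.
apply: (bounded_measurable_dsum gamma0 gamma1 (C := C)).
- by move=> t; exact: bounded_measurable_iter_step.
- by move=> t x; exact: iter_step_norm_le.
Qed.

Lemma potential_norm_le C f x : bounded_measurable f -> (forall z, `|f z| <= C) ->
  `|potential f x| <= C / (1 - gamma).
Proof. by move=> bf fC; apply: dsum_norm_le => // t; exact: iter_step_norm_le. Qed.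

Lemma step_potential f x : bounded_measurable f ->
  step (potential f) x = dsum gamma (fun t => iter t.+1 step f x).
Proof.
move=> bf; have [C C0 fC] := bounded_measurable_ge0 bf.
apply: (mean_dsum gamma0 gamma1 (C := C) (mean_step x)).
- by move=> t; exact: bounded_measurable_iter_step.
- by move=> t y; exact: iter_step_norm_le.
Qed.

(** [potential] is the resolvent of [step], and this is its resolvent identity: the Bellman equation
    when [f] is the reward. *)
Lemma potentialE f x : bounded_measurable f ->
  potential f x = f x + gamma * step (potential f) x.
Proof.
move=> bf; have [C C0 fC] := bounded_measurable_ge0 bf.
rewrite step_potential// /potential (dsum_recl gamma0 gamma1 (C := C))//.
by move=> t; exact: iter_step_norm_le.
Qed.

(** Since [step] does not increase sup bounds, each use of the hypothesis turns a bound
    [e / (1 - gamma) + c] into [e / (1 - gamma) + gamma * c]; starting from any bound of [u], the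
    excess tends to zero. This is the quantitative form of the contraction: every later estimate on
    a solution of a Bellman equation comes from an estimate on its source. *)
Lemma step_fixpoint_norm_le e u x : bounded_measurable u ->
  (forall y, `|u y - gamma * step u y| <= e) -> `|u x| <= e / (1 - gamma).
Proof.
move=> bu ue; have [C C0 uC] := bounded_measurable_ge0 bu.
have g10 : 1 - gamma != 0 by rewrite subr_eq0 gt_eqF.
have H n y : `|u y| <= e / (1 - gamma) + C * gamma ^+ n.
  elim: n y => [|n IH] y.
    rewrite expr0 mulr1 (le_trans (uC y))// lerDr divr_ge0 ?subr_ge0 ?(ltW gamma1)//.
    exact: le_trans (ue x).
  rewrite -(subrK (gamma * step u y) (u y)) (le_trans (ler_normD _ _))//.
  have -> : e / (1 - gamma) + C * gamma ^+ n.+1 =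
      e + gamma * (e / (1 - gamma) + C * gamma ^+ n).
    by rewrite exprS; field.
  rewrite lerD// normrM ger0_norm// ler_wpM2l//.
  exact: (mean_norm_le (mean_step y)).
have cvgH : e / (1 - gamma) + C * gamma ^+ n @[n --> \oo] --> e / (1 - gamma) + 0.
  apply: cvgD; first exact: cvg_cst.
  by apply: cvg_geometric; rewrite ger0_norm.
rewrite addr0 in cvgH; rewrite -(cvg_lim (@Rhausdorff R) cvgH); apply: limr_ge.
  by apply/cvg_ex; eexists; exact: cvgH.
by apply: nearW => n; exact: H.
Qed.

End policy_operators.

(** * Conditional sampling *)

(** Uniqueness of measures on a generating pi-system. A [mean] has no prescribed total mass, which
    is why agreement on [cst 1] is a separate hypothesis. *)
Lemma mean_unique {R : realType} d (T : measurableType d) (G : set_system T)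
    (L1 L2 : (T -> R) -> R) :
  @measurable _ T = <<s G >> -> setI_closed G -> mean L1 -> mean L2 ->
  L1 (cst 1) = L2 (cst 1) -> (forall B, G B -> L1 (\1_B) = L2 (\1_B)) ->
  forall f, bounded_measurable f -> L1 f = L2 f.
Proof.
move=> GE GI m1 m2 L11 LG; apply: (bounded_monotone_class GE GI) => //.
- move=> a f g bf bg Lf Lg; have baf := bounded_measurableZ a bf.
  by rewrite (meanD m1)// (meanD m2)// (meanZ m1)// (meanZ m2)// Lf Lg.
- move=> f_ f C bf fC ff Lf; apply: (cvg_unique (@Rhausdorff R) (mean_cvg m1 bf fC ff)).
  rewrite (_ : (fun n => L1 (f_ n)) = fun n => L2 (f_ n)); last exact/funext.
  exact: (mean_cvg m2 bf fC ff).
Qed.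

Lemma mean_unique_prod {R : realType} d d' (X : measurableType d)
    (Y : measurableType d') (L1 L2 : (X * Y -> R) -> R) :
  mean L1 -> mean L2 ->
  (forall B C, measurable B -> measurable C -> L1 (\1_(B `*` C)) = L2 (\1_(B `*` C))) ->
  forall f, bounded_measurable f -> L1 f = L2 f.
Proof.
move=> m1 m2 LX.
apply: (mean_unique (measurable_prod_measurableType X Y) _ m1 m2).
- exact: setI_closed_rectangles.
- by have := LX _ _ measurableT measurableT; rewrite setXTT indicT.
- by move=> _ [B mB [C mC <-]]; exact: LX.
Qed.

(** A [mean] may be signed, so any weight bounded by one is allowed; that bound is what preserves
    [mean_norm_le]. *)
Lemma mean_mulr {R : realType} d (T : measurableType d) (L : (T -> R) -> R) (h : T -> R) :
  mean L -> bounded_measurable h -> (forall x, `|h x| <= 1) ->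
  mean (fun f => L (fun x => f x * h x)).
Proof.
move=> mL bh h1; have bM f : bounded_measurable f ->
  bounded_measurable (fun x => f x * h x) by move=> bf; exact: bounded_measurableM.
have leM C f : (forall x, `|f x| <= C) -> forall x, `|f x * h x| <= C.
  by move=> fC x; rewrite normrM (le_trans _ (fC x))// ler_piMr.
split.
- move=> f g bf bg; rewrite -(meanD mL)//; [|exact: bM..].
  by congr L; apply/funext => x; rewrite mulrDl.
- move=> a f bf; rewrite -(meanZ mL)//; last exact: bM.
  by congr L; apply/funext => x; rewrite mulrA.
- move=> C f bf fC; apply: (mean_norm_le mL); first exact: bM.
  exact: leM.
- move=> f_ f C bf fC ff; apply: (mean_cvg mL (C := C)).
  + by move=> n; exact: bM.
  + by move=> n; exact: leM.
  + by move=> x; apply: cvgMr_tmp; exact: ff.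
Qed.

Section adapted.
Context {dO : measure_display} {Omega : measurableType dO}.
Implicit Types G : set_system Omega.

Definition adapted G {dX} {X : measurableType dX} (x : Omega -> X) : Prop :=
  forall B, measurable B -> <<s G >> (x @^-1` B).

Lemma adaptedP G dX (X : measurableType dX) (x : Omega -> X) :
  adapted G x <-> measurable_fun setT (x : g_sigma_algebraType G -> X).
Proof.
split => [ax _ B mB|mx B mB]; first by rewrite setTI; exact: ax.
by have := mx measurableT B mB; rewrite setTI.
Qed.

Lemma adapted_sub G G' dX (X : measurableType dX) (x : Omega -> X) :
  G `<=` G' -> adapted G x -> adapted G' x.
Proof. by move=> GG ax B mB; apply: (sub_sigma_algebra2 GG); exact: ax. Qed.

Lemma adapted_events G dX (X : measurableType dX) (x : Omega -> X) :
  events_of x `<=` G -> adapted G x.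
Proof.
move=> xG B mB; apply: sub_sigma_algebra; apply: xG.
by exists B => //; rewrite setTI.
Qed.

Lemma adapted_comp G dX dY (X : measurableType dX) (Y : measurableType dY)
    (x : Omega -> X) (f : X -> Y) :
  adapted G x -> measurable_fun setT f -> adapted G (f \o x).
Proof.
move=> ax mf B mB; suff fB : measurable (f @^-1` B) by exact: ax fB.
by have := mf measurableT B mB; rewrite setTI.
Qed.

Lemma adapted_pair G dX dY (X : measurableType dX) (Y : measurableType dY)
    (x : Omega -> X) (y : Omega -> Y) :
  adapted G x -> adapted G y -> adapted G (fun w => (x w, y w)).
Proof.
by move=> /adaptedP mx /adaptedP my; apply/adaptedP; exact: measurable_fun_pair.
Qed.

Lemma adapted_measurable G dX (X : measurableType dX) (x : Omega -> X) :
  G `<=` measurable -> adapted G x -> measurable_fun setT x.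
Proof.
move=> GO ax _ B mB; rewrite setTI.
by apply: (smallest_sub (@sigma_algebra_measurable _ Omega) GO); exact: ax.
Qed.

Lemma adaptedM {R : realType} G (x y : Omega -> R) :
  adapted G x -> adapted G y -> adapted G (fun w => x w * y w).
Proof.
by move=> /adaptedP mx /adaptedP my; apply/adaptedP; exact: measurable_funM.
Qed.

Lemma events_of_measurable dX (X : measurableType dX) (x : Omega -> X) :
  measurable_fun setT x -> events_of x `<=` measurable.
Proof. by move=> mx _ [B mB <-]; exact: mx. Qed.

End adapted.

Section drawn.
Context {R : realType} {dO : measure_display} {Omega : measurableType dO}.
Variable P : probability Omega R.

Let mean_P : mean (fun f : Omega -> R => \int[P]_w f w).
Proof. by apply: mean_bint; exact: probability_setT. Qed.

Section kernel_law.
Context {dX dY : measure_display} {X : measurableType dX} {Y : measurableType dY}.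
Variables (G : set_system Omega) (x : Omega -> X) (y : Omega -> Y) (k : R.-pker Y ~> X).
Hypotheses (GO : G `<=` measurable) (xP : drawn P G x (fun w => k (y w))).
Hypothesis yG : adapted G y.

Let my : measurable_fun setT y. Proof. exact: adapted_measurable GO yG. Qed.
Let mx : measurable_fun setT x. Proof. exact: xP.1. Qed.

Let kC_bounded (C : set X) : measurable C ->
  bounded_measurable (fun z => fine (k z C)) /\ forall z, `|fine (k z C)| <= 1.
Proof.
move=> mC; have kle z : `|fine (k z C)| <= 1.
  rewrite -bint_indic//; apply: bint_norm_le; first exact: prob_kernel.
    exact: bounded_measurable_indic.
  by move=> ?; rewrite indicE; case: (_ \in _); rewrite ?normr1 ?normr0.
split => //; split; last by exists 1.
by apply: measurableT_comp => //; exact: measurable_kernel.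
Qed.

Let indic_le1 T (B : set T) t : `|\1_B t : R| <= 1.
Proof. by rewrite indicE; case: (_ \in _); rewrite ?normr1 ?normr0. Qed.

(** [drawn] states this for [F] the indicator of a past event. Seen on the measurable space
    generated by [G], both sides are means in [F] that agree on indicators, and an adapted [F] is
    just a measurable function there. *)
Lemma drawn_set (F : Omega -> R) C : adapted G F -> (exists D, forall w, `|F w| <= D) ->
  measurable C ->
  \int[P]_w (F w * \1_C (x w)) = \int[P]_w (F w * fine (k (y w) C)).
Proof.
move=> aF bF mC; pose GT : measurableType _ := g_sigma_algebraType G.
have [bk kle] := kC_bounded mC.
(* The identity is measurable towards the coarser sigma-algebra, so the means of [Omega] restrict to
   it. *)
have m_id : measurable_fun setT (id : Omega -> GT).
  move=> _ B mB; rewrite setTI.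
  exact: (smallest_sub (@sigma_algebra_measurable _ Omega) GO).
have mL (h : Omega -> R) : bounded_measurable h -> (forall w, `|h w| <= 1) ->
    mean (fun f : GT -> R => \int[P]_w (f w * h w)).
  by move=> bh hle; exact: (mean_precomp (mean_mulr mean_P bh hle) m_id).
have drawnE E : <<s G >> E ->
    \int[P]_w (\1_E w * \1_C (x w)) = \int[P]_w (\1_E w * fine (k (y w) C)).
  move=> GE; have mE : measurable E.
    exact: (smallest_sub (@sigma_algebra_measurable _ Omega) GO).
  have mxC : measurable (x @^-1` C) by have := mx measurableT mC; rewrite setTI.
  transitivity (fine (P (E `&` x @^-1` C))).
    rewrite -bint_indic//; last exact: measurableI.
    by apply: eq_Rintegral => w _; rewrite indicI.
  rewrite (xP.2 E C GE mC) integral_mkcond; congr fine; apply: eq_integral => w _.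
  rewrite /patch indicE; case: (w \in E); last by rewrite mul0r.
  rewrite mul1r fineK// fin_num_abs gee0_abs//.
  rewrite (le_lt_trans (y := k (y w) setT)) ?le_measure ?inE//.
  by rewrite prob_kernel ltry.
apply: (@mean_unique _ _ GT (@measurable _ GT)
    (fun f : GT -> R => \int[P]_w (f w * \1_C (x w)))
    (fun f : GT -> R => \int[P]_w (f w * fine (k (y w) C)))) => /=.
- by rewrite sigma_algebra_id//; exact: sigma_algebra_measurable.
- by move=> ? ? ? ?; exact: measurableI.
- apply: mL; last by move=> w; exact: indic_le1.
  exact: (bounded_measurable_comp (bounded_measurable_indic mC) mx).
- by apply: mL; [exact: (bounded_measurable_comp bk my)|].
- by have := drawnE setT; rewrite indicT; apply; exact: (@measurableT _ GT).
- exact: drawnE.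
- by split => //; exact/adaptedP.
Qed.

(** On a rectangle [B * C] the factor in [y] is adapted and joins [F], which leaves [drawn_set]. The
    uniqueness of means then gives all bounded [f]: the parameter [y] is frozen while [x] is
    averaged. *)
Lemma drawn_integral (F : Omega -> R) (f : Y * X -> R) : adapted G F ->
  (exists D, forall w, `|F w| <= D) -> bounded_measurable f ->
  \int[P]_w (F w * f (y w, x w)) = \int[P]_w (F w * kint k f (y w)).
Proof.
move=> aF [D FD] bf; have mF : measurable_fun setT F by exact: adapted_measurable GO aF.
have myx : measurable_fun setT (fun w => (y w, x w)) by exact: measurable_fun_pair.
(* Rescaling brings the weight below one, as [mean_mulr] requires; the added one keeps the scale
   positive. *)
pose c := `|D| + 1; have c0 : 0 < c by rewrite ltr_wpDl.
pose F1 w := c^-1 * F w.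
have bF1 : bounded_measurable F1 by apply: bounded_measurableZ; split; last by exists D.
have F1le w : `|F1 w| <= 1.
  rewrite normrM gtr0_norm ?invr_gt0// mulrC ler_pdivrMr// mul1r.
  by rewrite (le_trans (FD w))// (le_trans (ler_norm D))// lerDl.
have FE (h : Omega -> R) : bounded_measurable h ->
    \int[P]_w (F w * h w) = c * \int[P]_w (h w * F1 w).
  move=> bh; rewrite -(meanZ mean_P); last exact: bounded_measurableM.
  by apply: eq_Rintegral => w _; rewrite /F1; field; rewrite gt_eqF.
rewrite !FE; [congr (_ * _)|..]; last 2 first.
- exact: (bounded_measurable_comp (bounded_measurable_kint k bf) my).
- exact: (bounded_measurable_comp bf myx).
have mL := mean_mulr mean_P bF1 F1le.
have mL2 := mean_comp (mean_precomp mL my) (mean_kint k)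
  (@bounded_measurable_kint _ _ _ _ _ k).
refine (mean_unique_prod (mean_precomp mL myx) mL2 _ bf) => B C mB mC /=.
have yB : measurable (y @^-1` B) by have := my measurableT mB; rewrite setTI.
transitivity (\int[P]_w (F1 w * \1_B (y w) * \1_C (x w))).
  by apply: eq_Rintegral => w _; rewrite !indicE in_setX -mulnb natrM; ring.
rewrite drawn_set//.
- by apply: eq_Rintegral => w _; rewrite kint_indicX//; ring.
- apply: adaptedM; last by apply: (adapted_comp yG); exact: measurable_indic.
  by apply: (adapted_comp aF); exact: measurable_funM.
- by exists 1 => w; rewrite normrM (le_trans _ (F1le w))// ler_piMr// indic_le1.
Qed.

End kernel_law.
End drawn.

(** * Rollouts *)

Section rollouts.
Context {R : realType} {dO dS dA : measure_display}.
Context {Omega : measurableType dO} {S : measurableType dS} {A : measurableType dA}.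
Variables (P : probability Omega R) (G : set_system Omega).
Variables (Ptr : R.-pker S * A ~> S) (pol : R.-pker S ~> A).
Variables (st : nat -> Omega -> S) (ac : nat -> Omega -> A).
Hypotheses (GO : G `<=` measurable) (trans : transitions P G Ptr pol st ac).
Hypotheses (mst0 : measurable_fun setT (st 0%N)) (mac0 : measurable_fun setT (ac 0%N)).
Implicit Types (F : Omega -> R) (f : S * A -> R).

Lemma measurable_rollout_state t : measurable_fun setT (st t).
Proof. by case: t => [//|t]; have [[]] := trans t. Qed.

Lemma measurable_rollout_action t : measurable_fun setT (ac t).
Proof. by case: t => [//|t]; have [_ []] := trans t. Qed.

Lemma trajectory_events_measurable : trajectory_events st ac `<=` measurable.
Proof.
apply: bigcup_sub => t _; rewrite subUset; split; apply: events_of_measurable.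
- exact: measurable_rollout_state.
- exact: measurable_rollout_action.
Qed.

Let history_measurable t : history st ac t `<=` measurable.
Proof.
apply: bigcup_sub => i _ B GB; apply: trajectory_events_measurable.
by exists i.
Qed.

(** The last action is averaged against the policy, then the last state against the transition
    kernel. This replaces [f] at time [t.+1] by [step f] at time [t], so the induction must quantify
    over [f]; the weight [F] is known before the trajectory and stays in front. *)
Lemma transitions_integral F f t : adapted G F -> (exists D, forall w, `|F w| <= D) ->
  bounded_measurable f ->
  \int[P]_w (F w * f (st t w, ac t w)) =
  \int[P]_w (F w * iter t (step Ptr pol) f (st 0%N w, ac 0%N w)).
Proof.
move=> aF bF; elim: t f => [//|t IH] f bf.
have bpf : bounded_measurable (kint pol f) by exact: bounded_measurable_kint.
have [drawn_st drawn_ac] := trans t.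
rewrite iterSr -IH; last exact: bounded_measurable_step.
have GtO : G `|` history st ac t.+1 `<=` measurable by rewrite subUset.
rewrite (drawn_integral _ drawn_ac)//; last 3 first.
- rewrite subUset; split => //; apply: events_of_measurable.
  exact: measurable_rollout_state.
- by apply: adapted_events; exact: subsetUr.
- by apply: adapted_sub aF => B GB; left; left.
have st_ac_adapted : adapted (G `|` history st ac t.+1) (fun w => (st t w, ac t w)).
  apply: adapted_pair; apply: adapted_events => B GB; right; exists t => //=.
  - by left.
  - by right.
rewrite (drawn_integral GtO drawn_st st_ac_adapted (f := kint pol f \o snd))//.
- by apply: adapted_sub aF => B GB; left.
- exact: (bounded_measurable_comp bpf measurable_snd).
Qed.

End rollouts.

Section started_rollouts.
Context {R : realType} {dO dS dA : measure_display}.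
Context {Omega : measurableType dO} {S : measurableType dS} {A : measurableType dA}.
Variables (P : probability Omega R) (G : set_system Omega).
Variables (Ptr : R.-pker S * A ~> S) (pol : R.-pker S ~> A).
Variables (x : Omega -> S) (y : Omega -> A).
Variables (st : nat -> Omega -> S) (ac : nat -> Omega -> A).
Hypotheses (GO : G `<=` measurable).
Hypotheses (mx : measurable_fun setT x) (my : measurable_fun setT y).
Implicit Types (F : Omega -> R) (f : S * A -> R).

Lemma state_rollout_measurable : state_rollout P G Ptr pol x st ac ->
  (forall t, measurable_fun setT (fun w => (st t w, ac t w))) /\
  trajectory_events st ac `<=` measurable.
Proof.
move=> [mst0 _ [mac0 _] trans]; split => [t|].
  apply: measurable_fun_pair.
    exact: measurable_rollout_state trans mst0 t.
  exact: measurable_rollout_action trans mac0 t.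
exact: trajectory_events_measurable trans mst0 mac0.
Qed.

Lemma pair_rollout_measurable : pair_rollout P G Ptr pol x y st ac ->
  (forall t, measurable_fun setT (fun w => (st t w, ac t w))) /\
  trajectory_events st ac `<=` measurable.
Proof.
move=> [mst0 mac0 _ trans]; split => [t|].
  apply: measurable_fun_pair.
    exact: measurable_rollout_state trans mst0 t.
  exact: measurable_rollout_action trans mac0 t.
exact: trajectory_events_measurable trans mst0 mac0.
Qed.

Lemma state_rollout_integral F f t : state_rollout P G Ptr pol x st ac ->
  adapted G F -> (exists D, forall w, `|F w| <= D) -> bounded_measurable f ->
  \int[P]_w (F w * f (st t w, ac t w)) =
  \int[P]_w (F w * kint pol (iter t (step Ptr pol) f) (x w)).
Proof.
move=> [mst0 st0E drawn0 trans] aF bF bf.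
have btf := bounded_measurable_iter_step Ptr pol t bf.
rewrite (transitions_integral GO trans mst0 drawn0.1)//.
rewrite (drawn_integral _ drawn0)//; last 3 first.
- by rewrite subUset; split => //; exact: events_of_measurable.
- by apply: adapted_events; exact: subsetUr.
- by apply: adapted_sub aF => B GB; left.
have mF : measurable_fun setT F := adapted_measurable GO aF.
(* The trajectory starts at [x] only almost surely. *)
apply: bint_ae_eq; last by apply: filterS st0E => w ->.
- apply: measurable_funM => //; apply: (measurableT_comp (f := kint pol _)) => //.
  exact: (bounded_measurable_kint pol btf).1.
- apply: measurable_funM => //; apply: (measurableT_comp (f := kint pol _)) => //.
  exact: (bounded_measurable_kint pol btf).1.
Qed.

Lemma pair_rollout_integral F f t : pair_rollout P G Ptr pol x y st ac ->
  adapted G F -> (exists D, forall w, `|F w| <= D) -> bounded_measurable f ->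
  \int[P]_w (F w * f (st t w, ac t w)) =
  \int[P]_w (F w * iter t (step Ptr pol) f (x w, y w)).
Proof.
move=> [mst0 mac0 st0E trans] aF bF bf.
have btf := bounded_measurable_iter_step Ptr pol t bf.
rewrite (transitions_integral GO trans mst0 mac0)//.
have mF : measurable_fun setT F := adapted_measurable GO aF.
apply: bint_ae_eq; last by apply: filterS st0E => w [-> ->].
- apply: measurable_funM => //; apply: (measurableT_comp (f := iter _ _ _)).
    exact: btf.1.
  exact: measurable_fun_pair.
- apply: measurable_funM => //; apply: (measurableT_comp (f := iter _ _ _)).
    exact: btf.1.
  exact: measurable_fun_pair.
Qed.

End started_rollouts.

(** * Euclidean estimates and differentiability *)

Section euclidean_norm.
Context {R : realType} {d : nat}.
Implicit Types u v : 'rV[R]_d.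

Definition dot u v : R := \sum_(i < d) u ord0 i * v ord0 i.

Lemma enorm_ge0 v : 0 <= enorm v.
Proof. exact: sqrtr_ge0. Qed.

Lemma sqr_enorm v : enorm v ^+ 2 = dot v v.
Proof.
rewrite sqr_sqrtr; first by apply: eq_bigr => i _; rewrite expr2.
by apply: sumr_ge0 => i _; rewrite sqr_ge0.
Qed.

Lemma dotDZ u v w a b : dot u (a *: v + b *: w) = a * dot u v + b * dot u w.
Proof.
rewrite /dot !mulr_sumr -big_split; apply: eq_bigr => i _.
by rewrite !mxE /=; ring.
Qed.

Lemma dotC u v : dot u v = dot v u.
Proof. by apply: eq_bigr => i _; rewrite mulrC. Qed.

Lemma dotZ u v a : dot u (a *: v) = a * dot u v.
Proof. by have := dotDZ u v 0 a 0; rewrite scaler0 addr0 mul0r addr0. Qed.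

Lemma dotBl u v w : dot (u - v) w = dot u w - dot v w.
Proof.
by rewrite !(dotC _ w); have := dotDZ w u v 1 (-1); rewrite scale1r scaleN1r mul1r mulN1r.
Qed.

Lemma dot_norm_le u v : `|dot u v| <= enorm u * enorm v.
Proof.
have [u0|u0] := eqVneq (enorm u) 0.
  rewrite u0 mul0r normr_le0 /dot; apply/eqP; apply: big1 => i _.
  have : dot u u = 0 by rewrite -sqr_enorm u0 expr0n.
  move=> /eqP; rewrite psumr_eq0; last by move=> j _; rewrite -expr2 sqr_ge0.
  move=> /allP /(_ i); rewrite mem_index_enum => /(_ isT) /=.
  by rewrite mulf_eq0 orbb => /eqP ->; rewrite mul0r.
have u_gt0 : 0 < enorm u by rewrite lt_def u0 enorm_ge0.
rewrite -ler_sqr ?nnegrE ?mulr_ge0 ?enorm_ge0// exprMn real_normK ?num_real// !sqr_enorm.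
(* This is the part of [v] orthogonal to [u], multiplied by [dot u u] to avoid a division; the sign
   of its square is the Cauchy-Schwarz inequality. *)
pose w := dot u u *: v - dot u v *: u.
have : 0 <= dot w w by rewrite -sqr_enorm sqr_ge0.
have -> : dot w w = dot u u * (dot u u * dot v v - dot u v ^+ 2).
  rewrite /w -scaleNr dotDZ !(dotC (_ + _)) !dotDZ (dotC v u); ring.
by rewrite pmulr_rge0 ?subr_ge0// -sqr_enorm exprn_gt0.
Qed.

Lemma enormZ a v : enorm (a *: v) = `|a| * enorm v.
Proof.
rewrite /enorm -sqrtr_sqr -sqrtrM ?sqr_ge0//; congr Num.sqrt.
by rewrite mulr_sumr; apply: eq_bigr => i _; rewrite mxE exprMn.
Qed.

Lemma coord_norm_le v i : `|v ord0 i| <= enorm v.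
Proof.
rewrite -ler_sqr ?nnegrE ?enorm_ge0// real_normK ?num_real// sqr_enorm.
rewrite /dot (bigD1 i)//= expr2 lerDl; apply: sumr_ge0 => j _.
by rewrite -expr2 sqr_ge0.
Qed.

Lemma enorm_le_norm v : enorm v <= Num.sqrt d%:R * `|v|.
Proof.
rewrite -ler_sqr ?nnegrE ?mulr_ge0 ?sqrtr_ge0 ?enorm_ge0//.
rewrite sqr_enorm exprMn sqr_sqrtr ?ler0n//.
rewrite (@le_trans _ _ (\sum_(i < d) `|v| ^+ 2))//; last first.
  by rewrite sumr_const card_ord mulr_natl.
apply: ler_sum => i _; rewrite -expr2 -real_normK ?num_real// lerXn2r ?nnegrE//.
by rewrite /Num.Def.normr /= mx_normrE (le_trans _ (le_bigmax _ _ (ord0, i))).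
Qed.

(** Bounds a vector by testing it against itself, which keeps the Euclidean constant free of the
    dimension. *)
Lemma enorm_le_dot v c : 0 <= c -> dot v v <= c * enorm v -> enorm v <= c.
Proof.
move=> c0; rewrite -sqr_enorm expr2; have := enorm_ge0 v.
by rewrite le_eqVlt => /predU1P[<-//|v0]; rewrite ler_pM2r.
Qed.

Lemma row_dot (f : {linear 'rV[R]_d -> R}) v :
  f v = \sum_(i < d) v ord0 i * f (delta_mx ord0 i).
Proof.
rewrite [in LHS](row_sum_delta v) linear_sum.
by apply: eq_bigr => i _; rewrite linearZ.
Qed.

Lemma dot_delta u i : dot u (delta_mx ord0 i) = u ord0 i.
Proof.
rewrite /dot (bigD1 i)//= big1 => [|j ji]; first by rewrite mxE !eqxx mulr1 addr0.
by rewrite mxE (negbTE ji) andbF mulr0.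
Qed.

Let dot_linear u : linear (dot u).
Proof. by move=> a v w; have := dotDZ u v w a 1; rewrite scale1r mul1r. Qed.

HB.instance Definition _ u :=
  GRing.isLinear.Build R 'rV[R]_d R *:%R (dot u) (dot_linear u).

Lemma dot_continuous u : continuous (dot u).
Proof.
apply: bounded_linear_continuous; apply/linear_boundedP.
near=> r => v; rewrite (le_trans (dot_norm_le u v))//.
rewrite (@le_trans _ _ (enorm u * (Num.sqrt d%:R * `|v|)))//.
  by rewrite ler_wpM2l ?enorm_ge0// enorm_le_norm.
rewrite mulrA ler_wpM2r//; near: r; exact: nbhs_pinfty_ge (num_real _).
Unshelve. all: by end_near.
Qed.

End euclidean_norm.

Lemma differentiable_littleo {R : realType} (V W : normedModType R) (f : V -> W)
    (df : {linear V -> W}) (x : V) : continuous df ->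
  (forall eps : R, 0 < eps -> exists2 r : R, 0 < r &
     forall h, `|h| <= r -> `|f (h + x) - f x - df h| <= eps * `|h|) ->
  differentiable f x /\ 'd f x = df :> (V -> W).
Proof.
move=> cdf fo; have fo' : f \o shift x = cst (f x) + df +o_ 0 id.
  apply/eqaddoP => eps eps0; have [r r0 fr] := fo _ eps0.
  near=> h; rewrite /= !fctE opprD addrA; apply: fr.
  by near: h; exact: nbhs0_le.
have dE := diff_unique cdf fo'; split => //.
by apply/diff_locallyP; rewrite dE; split.
Unshelve. all: by end_near.
Qed.

Section differentiability.
Context {R : realType} {d : nat}.
Implicit Types (f : 'rV[R]_d -> R) (x h v : 'rV[R]_d).

Lemma diff_dot_gradient f x h : differentiable f x -> 'd f x h = dot (gradient f x) h.
Proof.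
move=> df; rewrite row_dot; apply: eq_bigr => i _.
by rewrite mxE deriveE// mulrC.
Qed.

Lemma differentiable_quadratic f x v C e : 0 < e ->
  (forall h, enorm h <= e -> `|f (h + x) - f x - dot v h| <= C * enorm h ^+ 2) ->
  differentiable f x /\ gradient f x = v.
Proof.
move=> e0 fC; pose c := Num.sqrt d%:R : R.
have c0 : 0 <= c by exact: sqrtr_ge0.
have c10 : 0 < c + 1 by rewrite ltr_wpDl.
have [|df dE] := differentiable_littleo (@dot_continuous R d v) (f := f) (x := x).
  move=> eps eps0; pose c1 := `|C| * c ^+ 2.
  have c10' : 0 < c1 + 1 by rewrite ltr_wpDl// mulr_ge0// sqr_ge0.
  (* The first radius, in sup norm, lands in the Euclidean ball of radius [e]; the second makes
     [c1 * |h|] at most [eps]. The added ones keep the denominators positive. *)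
  exists (Num.min (e / (c + 1)) (eps / (c1 + 1))).
    by rewrite lt_min !divr_gt0.
  move=> h; rewrite le_min !ler_pdivlMr// => /andP[hr1 hr2].
  have hle : enorm h <= c * `|h| by exact: enorm_le_norm.
  have he : enorm h <= e.
    by rewrite (le_trans hle)// (le_trans _ hr1)// mulrC ler_wpM2l// lerDl.
  rewrite (le_trans (fC h he))// (@le_trans _ _ (c1 * `|h| * `|h|))//.
    rewrite (@le_trans _ _ (`|C| * enorm h ^+ 2))//.
      by rewrite ler_wpM2r ?sqr_ge0// ler_norm.
    rewrite /c1 -!mulrA ler_wpM2l// (_ : _ * _ = (c * `|h|) ^+ 2); last by ring.
    rewrite lerXn2r// nnegrE ?enorm_ge0//.
    by rewrite mulr_ge0.
  by rewrite ler_wpM2r// (le_trans _ hr2)// mulrC ler_wpM2l// lerDl.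
split => //; apply/rowP => i; rewrite mxE deriveE// dE; exact: dot_delta.
Qed.

(** The mean value theorem along the segment gives the increment as the gradient at an intermediate
    point applied to [h]; the Lipschitz bound compares it with the gradient at [x]. The absolute
    value is there because [L] has no assumed sign. *)
Lemma segment_taylor f x h L : (forall y, differentiable f y) ->
  (forall y z, enorm (gradient f y - gradient f z) <= L * enorm (y - z)) ->
  `|f (h + x) - f x - dot (gradient f x) h| <= `|L| * enorm h ^+ 2.
Proof.
move=> df fL; pose phi (t : R) := f (t *: h + x).
have dphi (t : R) : is_derive t 1 phi (dot (gradient f (t *: h + x)) h).
  have phiE : (fun k : R => k^-1 *: ((phi \o shift t) (k *: 1) - phi t)) =
      (fun k : R => k^-1 *: ((f \o shift (t *: h + x)) (k *: h) - f (t *: h + x))).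
    apply/funext => k; rewrite /phi /= /shift/= (_ : k%:A = k) ?scalerDl ?addrA//.
    exact: mulr1.
  split; first by rewrite /derivable phiE; exact: diff_derivable.
  by rewrite /derive phiE -/(derive _ _ _) deriveE// diff_dot_gradient.
have [|c c01] := MVT_segment ler01 (fun t _ => dphi t).
  apply: derivable_within_continuous => t _; exact: ex_derive.
rewrite /phi scale1r scale0r add0r subr0 mulr1 => ->.
rewrite -dotBl (le_trans (dot_norm_le _ _))// expr2 mulrA ler_wpM2r ?enorm_ge0//.
rewrite (le_trans (fL _ _))// addrK enormZ.
have : 0 <= c <= 1 by rewrite in_itv/= in c01.
move=> /andP[c0 c1]; rewrite ger0_norm// mulrA (@le_trans _ _ (`|L| * c * enorm h))//.
  by rewrite !ler_wpM2r ?enorm_ge0// ler_norm.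
by rewrite ler_wpM2r ?enorm_ge0// ler_piMr.
Qed.

End differentiability.

(** From [1 - x <= expR (- x)] one gets [expR x * (1 - x) <= 1], so the remainder is at most
    [x ^+ 2 / (1 - x)]; the condition on [x] gives the constant two. *)
Lemma expR_taylor_le {R : realType} (x : R) : `|x| <= 2^-1 ->
  `|expR x - 1 - x| <= 2 * x ^+ 2.
Proof.
rewrite ler_norml => /andP[xl xu].
have e1 := expR_ge1Dx x; have e2 := expR_ge1Dx (- x).
rewrite ger0_norm; last by lra.
have : expR x * (1 - x) <= 1.
  rewrite -[leRHS](expRxMexpNx_1 x) ler_wpM2l ?expR_ge0//.
nra.
Qed.

(** * Change of policy *)

(** The measure [nu] may be infinite, so a constant need not be integrable; convergence is dominated
    by [C * p] instead. *)
Lemma mean_density {R : realType} d (T : measurableType d)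
    (nu : {measure set T -> \bar R}) (p : T -> R) :
  measurable_fun setT p -> (forall x, 0 <= p x) ->
  (\int[nu]_x (p x)%:E = 1)%E -> mean (fun f : T -> R => \int[nu]_x (f x * p x)).
Proof.
move=> mp p0 p1.
have ip : nu.-integrable setT (EFin \o p).
  apply/integrableP; split; first exact/measurable_EFinP.
  rewrite (_ : (\int[nu]_x _ = 1)%E) ?ltry//.
  by rewrite -[RHS]p1; apply: eq_integral => x _; rewrite /= ger0_norm.
have ifp (f : T -> R) : bounded_measurable f ->
    nu.-integrable setT (EFin \o (fun x => f x * p x)).
  move=> [mf [C fC]].
  apply: (le_integrable measurableT _ _ (integrableZl measurableT `|C| ip)).
    by apply/measurable_EFinP; exact: measurable_funM.
  move=> x _; rewrite /= lee_fin !normrM normr_id ler_wpM2r//.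
  by rewrite (le_trans (fC x))// ler_norm.
split.
- move=> f g bf bg; rewrite -RintegralD//; [|exact: ifp..].
  by apply: eq_Rintegral => x _; rewrite mulrDl.
- move=> a f bf; rewrite -RintegralZl//; last exact: ifp.
  by apply: eq_Rintegral => x _; rewrite mulrA.
- move=> C f bf fC; rewrite (le_trans (le_normr_Rintegral _ _))//; first exact: ifp.
  apply: (@le_trans _ _ (\int[nu]_x (C * p x))).
    apply: le_Rintegral => //.
    + by apply: integrable_norm; exact: ifp.
    + exact: (integrableZl measurableT C ip).
    + by move=> x _; rewrite normrM (ger0_norm (p0 x)) ler_wpM2r.
  by rewrite RintegralZl// /Rintegral p1 mulr1.
- move=> f_ f C bf fC ff.
  have bfl : bounded_measurable f.
    by apply: (bounded_measurable_lim _ fC ff) => n; exact: (bf n).1.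
  have [] := @dominated_convergence _ _ _ nu _ measurableT
    (fun n => EFin \o (fun x => f_ n x * p x)) (EFin \o (fun x => f x * p x))
    (EFin \o (fun x => C * p x)).
  + by move=> n; apply/measurable_EFinP; apply: measurable_funM => //; exact: (bf n).1.
  + by apply/measurable_EFinP; apply: measurable_funM => //; exact: bfl.1.
  + apply: aeW => x _; apply: cvg_EFin; first exact: nearW.
    by apply: cvgMr_tmp; exact: ff.
  + exact: (integrableZl measurableT C ip).
  + apply: aeW => x n _; rewrite lee_fin normrM (ger0_norm (p0 x)).
    by rewrite ler_wpM2r.
  move=> intf _; rewrite /Rintegral -[X in _ --> X -> _]fineK//.
    exact: fine_cvg.
  exact: integrable_fin_num.
Qed.

Section change_of_policy.
Context {R : realType} {dS dA : measure_display}.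
Context {S : measurableType dS} {A : measurableType dA}.
Variable nu : {measure set A -> \bar R}.
Implicit Types (pol : R.-pker S ~> A) (p w : S * A -> R) (f : S * A -> R).

Definition has_density pol p : Prop :=
  [/\ measurable_fun setT p, forall z, 0 <= p z &
    forall s B, measurable B -> pol s B = (\int[nu]_(a in B) (p (s, a))%:E)%E].

Lemma kint_density pol p f s : has_density pol p -> bounded_measurable f ->
  kint pol f s = \int[nu]_a (f (s, a) * p (s, a)).
Proof.
move=> [mp p0 pE] bf.
have mps : measurable_fun setT (fun a => p (s, a)).
  exact: (measurableT_comp mp (pair1_measurable s)).
have p1 : (\int[nu]_a (p (s, a))%:E = 1)%E by rewrite -pE// prob_kernel.
have m1 : mean (fun f : A -> R => \int[pol s]_a f a).
  by apply: mean_bint; exact: prob_kernel.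
have m2 := mean_density mps (fun a => p0 (s, a)) p1.
apply: (@mean_unique _ _ A measurable _ _ _ _ m1 m2 _ _ (fun a => f (s, a))) => /=.
- by rewrite sigma_algebra_id//; exact: sigma_algebra_measurable.
- by move=> ? ? ? ?; exact: measurableI.
- rewrite bint_cst; last exact: prob_kernel.
  under eq_Rintegral do rewrite mul1r.
  by rewrite /Rintegral p1.
- move=> B mB; rewrite bint_indic//.
  rewrite pE// integral_mkcond; congr fine; apply: eq_integral => a _.
  by rewrite /patch indicE; case: (a \in B); rewrite ?mul1r ?mul0r.
- exact: bounded_measurable_section.
Qed.

Lemma kint_change pol pol' p p' w f s : has_density pol p -> has_density pol' p' ->
  bounded_measurable w -> (forall z, w z * p z = p' z) -> bounded_measurable f ->
  kint pol' f s = kint pol (fun z => w z * f z) s.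
Proof.
move=> dp dp' bw wp bf; rewrite (kint_density _ dp')// (kint_density _ dp).
  by apply: eq_Rintegral => a _; rewrite -wp; ring.
exact: bounded_measurableM.
Qed.

End change_of_policy.

(** * The policy gradient *)

Section policy_gradient.
Context {R : realType} {dS dA : measure_display}.
Context {S : measurableType dS} {A : measurableType dA}.
Variables (d : nat) (Ptr : R.-pker S * A ~> S) (r : S * A -> R) (gamma : R).
Variables (pol : 'rV[R]_d -> R.-pker S ~> A) (nu : {measure set A -> \bar R}).
Variables (p : 'rV[R]_d -> S -> A -> R) (U_R L_Theta B_Theta : R).
Hypotheses (gamma0 : 0 <= gamma) (gamma1 : gamma < 1).
Hypotheses (r_meas : measurable_fun setT r) (r_bounded : forall s a, `|r (s, a)| <= U_R).
Hypothesis p_meas :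
  forall theta, measurable_fun setT (fun x : S * A => p theta x.1 x.2).
Hypothesis p_density : forall theta s (B : set A), measurable B ->
  pol theta s B = (\int[nu]_(a in B) (p theta s a)%:E)%E.
Hypothesis p_gt0 : forall theta s a, 0 < p theta s a.
Hypothesis p_diff : forall s a theta, differentiable (fun theta' => p theta' s a) theta.
Hypothesis score_lipschitz : forall s a theta1 theta2,
  enorm (score p theta1 s a - score p theta2 s a) <= L_Theta * enorm (theta1 - theta2).
Hypothesis score_bounded : forall s a theta, enorm (score p theta s a) <= B_Theta.

Variables (theta : 'rV[R]_d) (s0 : S).

Let phi (z : S * A) : 'rV[R]_d := score p theta z.1 z.2.
Let Q theta' : S * A -> R := potential gamma Ptr (pol theta') r.
(** The likelihood ratio of the shifted policy, in exponential form because the assumptions control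
    the increments of the log-density. *)
Let w h (z : S * A) : R := expR (ln (p (h + theta) z.1 z.2) - ln (p theta z.1 z.2)).

Lemma differentiable_ln_policy s a theta' :
  differentiable (fun theta => ln (p theta s a)) theta'.
Proof.
apply: (differentiable_comp (p_diff s a theta') (g := @ln R)).
by apply/derivable1_diffP; apply: ex_derive; exact: is_derive1_ln.
Qed.

(** Measurability in the pair is not assumed for the score; it is inherited from the difference
    quotients of [ln p] along the steps [1 / (n + 1)]. *)
Lemma bounded_measurable_score i : bounded_measurable (fun z => phi z ord0 i).
Proof.
split; last first.
  by exists B_Theta => z; rewrite (le_trans (coord_norm_le _ _))// score_bounded.
pose q (n : nat) (z : S * A) : R := (n.+1%:R^-1)^-1 *:
  (ln (p (n.+1%:R^-1 *: delta_mx ord0 i + theta) z.1 z.2) - ln (p theta z.1 z.2)).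
apply: (@measurable_fun_cvg _ _ _ _ q) => [n|z _].
  apply: measurable_funM => //; apply: measurable_funB;
    exact: (measurableT_comp (@measurable_ln R)).
have dn : derivable (fun theta => ln (p theta z.1 z.2)) theta (delta_mx ord0 i).
  by apply: diff_derivable; exact: differentiable_ln_policy.
have harmonic0 : n.+1%:R^-1 @[n --> \oo] --> (0 : R)^'.
  move=> P P0; have [N _ NP] := @cvg_harmonic R _ P0.
  by exists N => // n Nn; apply: (NP n Nn); rewrite /= invr_neq0// pnatr_eq0.
rewrite /phi /score /gradient mxE.
exact: (cvg_comp _ _ harmonic0 dn).
Qed.

(** With [x] the increment of the log-density, the summands bound [expR x - 1 - x] and
    [x - dot (phi z) h] respectively, in units of [enorm h ^+ 2]. *)
Let ratio_const := 2 * (`|L_Theta| + B_Theta) ^+ 2 + `|L_Theta|.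
(** The bound one absorbs the quadratic error of the log-density into a linear one; the other bound
    keeps its increment below one half, as [expR_taylor_le] needs. *)
Let radius := Num.min 1 (2^-1 / (`|L_Theta| + B_Theta + 1)).

Lemma B_Theta_ge0 : 0 <= B_Theta.
Proof. exact: le_trans (enorm_ge0 _) (score_bounded s0 point theta). Qed.

Let M_ge0 : 0 <= `|L_Theta| + B_Theta.
Proof. by rewrite addr_ge0// B_Theta_ge0. Qed.

Let radius_gt0 : 0 < radius.
Proof. by rewrite lt_min ltr01 divr_gt0// ltr_wpDl. Qed.

Lemma likelihood_ratio_taylor h z : enorm h <= radius ->
  `|w h z - 1 - dot (phi z) h| <= ratio_const * enorm h ^+ 2 /\
  `|w h z - 1| <= 2 * (`|L_Theta| + B_Theta) * enorm h.
Proof.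
rewrite le_min => /andP[h1]; rewrite ler_pdivlMr ?ltr_wpDl// => hM.
have h0 := enorm_ge0 h.
pose x := ln (p (h + theta) z.1 z.2) - ln (p theta z.1 z.2).
have xphi : `|x - dot (phi z) h| <= `|L_Theta| * enorm h ^+ 2.
  by apply: (segment_taylor (f := fun theta => ln (p theta z.1 z.2))) => *;
    [exact: differentiable_ln_policy|exact: score_lipschitz].
have phih : `|dot (phi z) h| <= B_Theta * enorm h.
  by rewrite (le_trans (dot_norm_le _ _))// ler_wpM2r// score_bounded.
have xM : `|x| <= (`|L_Theta| + B_Theta) * enorm h.
  rewrite -(subrK (dot (phi z) h) x) (le_trans (ler_normD _ _))// mulrDl lerD//.
  rewrite (le_trans xphi)// ler_wpM2l// expr2 ler_piMr//.
have x2 : `|x| <= 2^-1.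
  rewrite (le_trans xM)// (le_trans _ hM)// mulrC ler_wpM2l// lerDl//.
have ex := expR_taylor_le x2.
have xsq : x ^+ 2 <= ((`|L_Theta| + B_Theta) * enorm h) ^+ 2.
  by rewrite -(real_normK (num_real x)) lerXn2r// nnegrE// mulr_ge0.
split.
  rewrite (_ : w h z - 1 - _ = (expR x - 1 - x) + (x - dot (phi z) h)); last first.
    by rewrite /w -/x; ring.
  rewrite (le_trans (ler_normD _ _))// /ratio_const mulrDl lerD//.
  rewrite (le_trans ex)// -mulrA ler_wpM2l// -exprMn//.
(* As [|x|] is at most one half, [2 * x ^+ 2] is at most [|x|]; hence the factor two in this
   bound. *)
rewrite (_ : w h z - 1 = (expR x - 1 - x) + x); last by rewrite /w -/x; ring.
rewrite (le_trans (ler_normD _ _))// -mulrA mulr_natl mulr2n lerD//.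
rewrite (le_trans ex)// -real_normK ?num_real// (le_trans _ xM)//.
have := normr_ge0 x; nra.
Qed.

Let bounded_measurable_w h : enorm h <= radius -> bounded_measurable (w h).
Proof.
move=> hr; split.
  apply: (measurableT_comp (@measurable_expR R)); apply: measurable_funB;
    exact: (measurableT_comp (@measurable_ln R)).
exists (2 * (`|L_Theta| + B_Theta) * enorm h + 1) => z.
rewrite -[w h z](subrK 1) (le_trans (ler_normD _ _))// normr1 lerD2r.
by have [] := likelihood_ratio_taylor z hr.
Qed.

Let policy_density theta' : has_density nu (pol theta') (fun z => p theta' z.1 z.2).
Proof. by split => //; [move=> z; exact: ltW|move=> s B mB; exact: p_density]. Qed.

Lemma kint_policy_shift h f s : enorm h <= radius -> bounded_measurable f ->
  kint (pol (h + theta)) f s = kint (pol theta) (fun z => w h z * f z) s.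
Proof.
move=> hr bf; apply: (kint_change s (policy_density theta)
  (policy_density (h + theta))) => //.
  exact: bounded_measurable_w.
by move=> z; rewrite /w expRB !lnK ?posrE// divfK// gt_eqF.
Qed.

Let bounded_measurable_dot_score h : bounded_measurable (fun z => dot (phi z) h).
Proof.
apply: (bounded_measurable_sum (F := fun i z => phi z ord0 i * h ord0 i)) => i.
by apply: bounded_measurableM;
  [exact: bounded_measurable_score|exact: bounded_measurable_cst].
Qed.

(** Both policies have total mass one, so [w h - 1] has mean zero. For [h] of length [t] along a
    coordinate, the expansion of [w h] then gives [|t * m| <= ratio_const * t ^+ 2] for the mean
    [m]; dividing by [t] and letting it shrink leaves zero. *)
Lemma kint_score s i : kint (pol theta) (fun z => phi z ord0 i) s = 0.
Proof.
have mk := mean_kint (pol theta) s.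
set m := kint _ _ _.
have small (t : R) : 0 < t <= radius -> `|m| <= ratio_const * t.
  move=> /andP[t0 tr]; pose h : 'rV[R]_d := t *: delta_mx ord0 i.
  have eh : enorm h = t.
    rewrite enormZ gtr0_norm// /enorm (bigD1 i)//= big1 => [|j ji].
      by rewrite mxE !eqxx expr1n addr0 sqrtr1 mulr1.
    by rewrite mxE (negbTE ji) andbF expr0n.
  have hr : enorm h <= radius by rewrite eh.
  have bw := bounded_measurable_w hr.
  have b1 := bounded_measurable_cst (T := (S * A)%type) (1 : R).
  have w1 : kint (pol theta) (fun z => w h z - 1) s = 0.
    rewrite (meanB mk)//.
    have := kint_policy_shift s hr b1.
    under [X in _ = kint _ X _]eq_fun do rewrite mulr1.
    move=> <-; rewrite /kint !bint_cst ?subrr//; exact: prob_kernel.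
  have tm : t * m = kint (pol theta) (fun z => dot (phi z) h) s.
    rewrite /m -(meanZ mk); last exact: bounded_measurable_score.
    congr kint; apply/funext => z; rewrite /h dotZ dot_delta//.
  have : `|t * m| <= ratio_const * t ^+ 2.
    rewrite tm -normrN -[- _]add0r -w1 -(meanB mk)//.
      apply: (mean_norm_le mk) => [|z].
        by do 2 apply: bounded_measurableB => //.
      by rewrite -eh; exact: (likelihood_ratio_taylor z hr).1.
    exact: bounded_measurableB.
  by rewrite normrM gtr0_norm// expr2 mulrCA ler_pM2l.
apply/eqP; rewrite -normr_le0; apply/ler_addgt0Pr => e e0; rewrite add0r.
have C0 : 0 < ratio_const + 1.
  by rewrite ltr_wpDl// addr_ge0// mulr_ge0// sqr_ge0.
pose t := Num.min radius (e / (ratio_const + 1)).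
have t0 : 0 < t by rewrite lt_min radius_gt0 divr_gt0.
rewrite (le_trans (small t _))//; first by rewrite t0 ge_min lexx.
rewrite (@le_trans _ _ ((ratio_const + 1) * t))//.
  by rewrite ler_wpM2r ?(ltW t0)// lerDl.
by rewrite mulrC -ler_pdivlMr// ge_min lexx orbT.
Qed.

Let bounded_measurable_r : bounded_measurable r.
Proof. by split => //; exists U_R => -[s a]; exact: r_bounded. Qed.

Let bounded_measurable_Q theta' : bounded_measurable (Q theta').
Proof. exact: bounded_measurable_potential. Qed.

Let Q_norm_le theta' z : `|Q theta' z| <= U_R / (1 - gamma).
Proof. by apply: potential_norm_le => // -[s a]; exact: r_bounded. Qed.

Let one_gamma : 0 < 1 - gamma.
Proof. by rewrite subr_gt0. Qed.

(** Score times action value, not the difference between action and state values that often bears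
    this name. *)
Let advantage i (z : S * A) : R := phi z ord0 i * Q theta z.

Let bounded_measurable_advantage i : bounded_measurable (advantage i).
Proof. by apply: bounded_measurableM => //; exact: bounded_measurable_score. Qed.

(** The potential of [dot (phi z) h * Q theta z], expanded over the coordinates of [h] so that
    linearity in [h] is visible. *)
Let tangent (h : 'rV[R]_d) (z : S * A) : R :=
  \sum_(i < d) h ord0 i * potential gamma Ptr (pol theta) (advantage i) z.

Let bounded_measurable_tangent h : bounded_measurable (tangent h).
Proof.
apply: bounded_measurable_sum => i; apply: bounded_measurableZ.
exact: bounded_measurable_potential.
Qed.

Let tangentE h z :
  tangent h z - gamma * step Ptr (pol theta) (tangent h) z = dot (phi z) h * Q theta z.
Proof.
have bp i : bounded_measurable (potential gamma Ptr (pol theta) (advantage i)).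
  exact: bounded_measurable_potential.
rewrite (mean_sum (mean_step Ptr (pol theta) z)
  (F := fun i z => h ord0 i * potential gamma Ptr (pol theta) (advantage i) z)); last first.
  by move=> i; exact: bounded_measurableZ.
rewrite /tangent mulr_sumr -sumrB /dot mulr_suml; apply: eq_bigr => i _.
rewrite (meanZ (mean_step Ptr (pol theta) z))// potentialE// /advantage; ring.
Qed.

(** The formula of the policy gradient theorem: score times action value, integrated over the
    unnormalised discounted occupancy of the pairs visited from [s0]. *)
Definition policy_gradient : 'rV[R]_d := \row_(i < d)
  kint (pol theta) (potential gamma Ptr (pol theta) (fun z => phi z ord0 i * Q theta z)) s0.

Let dot_policy_gradient h : dot policy_gradient h = kint (pol theta) (tangent h) s0.
Proof.
have bp i : bounded_measurable (potential gamma Ptr (pol theta) (advantage i)).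
  exact: bounded_measurable_potential.
rewrite (mean_sum (mean_kint (pol theta) s0)
  (F := fun i z => h ord0 i * potential gamma Ptr (pol theta) (advantage i) z)); last first.
  by move=> i; exact: bounded_measurableZ.
apply: eq_bigr => i _; rewrite mxE (meanZ (mean_kint (pol theta) s0))// mulrC//.
Qed.

(** Tested against itself, the vector is the mean of [tangent], whose source is at most
    [B_Theta * enorm policy_gradient] times the bound [U_R / (1 - gamma)] of [Q]. The contraction
    supplies the second factor [(1 - gamma)^-1]. *)
Lemma enorm_policy_gradient :
  enorm policy_gradient <= B_Theta * U_R / (1 - gamma) ^+ 2.
Proof.
have U0 : 0 <= U_R by exact: le_trans (normr_ge0 _) (r_bounded s0 point).
apply: enorm_le_dot.
  by rewrite divr_ge0 ?sqr_ge0// mulr_ge0// B_Theta_ge0.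
rewrite (le_trans (ler_norm _))// dot_policy_gradient.
apply: (mean_norm_le (mean_kint (pol theta) s0)) => // z.
rewrite (_ : B_Theta * U_R / _ * _ =
  B_Theta * enorm policy_gradient * (U_R / (1 - gamma)) / (1 - gamma)); last first.
  by field; rewrite gt_eqF.
apply: (step_fixpoint_norm_le (Ptr := Ptr) (pol := pol theta) gamma0 gamma1
  (u := tangent _)) => // y.
rewrite tangentE normrM ler_pM//.
rewrite (le_trans (dot_norm_le _ _))// ler_wpM2r ?enorm_ge0//.
exact: score_bounded.
Qed.

(* With [E := w h * Q (h + theta) - Q theta], the Bellman equations of the two
   policies give [E - gamma K E = (w h - 1) Q (h + theta)], where [K] is the
   transition operator of [pol theta]; [tangent h] solves the same equation to
   first order in [h]. *)
Lemma policy_gradient_expansion h : enorm h <= radius ->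
  `|kint (pol (h + theta)) (Q (h + theta)) s0 - kint (pol theta) (Q theta) s0
    - dot policy_gradient h| <=
  (ratio_const * (U_R / (1 - gamma)) + (2 * (`|L_Theta| + B_Theta)) ^+ 2 *
    (U_R / (1 - gamma)) / (1 - gamma)) / (1 - gamma) * enorm h ^+ 2.
Proof.
move=> hr; have taylor z := likelihood_ratio_taylor z hr.
set UQ := U_R / (1 - gamma); set M := 2 * (`|L_Theta| + B_Theta).
have bw := bounded_measurable_w hr.
pose Q' := Q (h + theta).
have bQ' : bounded_measurable Q' by exact: bounded_measurable_Q.
have bwQ' : bounded_measurable (fun z => w h z * Q' z) by exact: bounded_measurableM.
have bQ : bounded_measurable (Q theta) := bounded_measurable_Q theta.
pose E z := w h z * Q' z - Q theta z.
have bE : bounded_measurable E := bounded_measurableB bwQ' bQ.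
have mk := mean_kint (pol theta) s0.
have mst z := mean_step Ptr (pol theta) z.
have stepQ' z : step Ptr (pol (h + theta)) Q' z =
    step Ptr (pol theta) (fun z => w h z * Q' z) z.
  have kE : kint (pol (h + theta)) Q' = kint (pol theta) (fun z => w h z * Q' z).
    by apply/funext => s; apply: kint_policy_shift hr bQ'.
  by rewrite /step kE.
have Q'E z : Q' z = r z + gamma * step Ptr (pol (h + theta)) Q' z.
  exact: potentialE.
have QE z : Q theta z = r z + gamma * step Ptr (pol theta) (Q theta) z.
  exact: potentialE.
have stepE z : step Ptr (pol theta) E z =
    step Ptr (pol theta) (fun z => w h z * Q' z) z - step Ptr (pol theta) (Q theta) z.
  exact: (meanB (mst z) bwQ' bQ).
have Q'QE z : Q' z - Q theta z = gamma * step Ptr (pol theta) E z.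
  rewrite [Q' z]Q'E [Q theta z]QE stepQ' stepE; ring.
have EE z : E z - gamma * step Ptr (pol theta) E z = (w h z - 1) * Q' z.
  by rewrite -Q'QE /E; ring.
(* A crude first-order bound, whose only purpose is to make [Q' - Q theta] of order [enorm h]. *)
have E_le z : `|E z| <= M * enorm h * UQ / (1 - gamma).
  apply: (step_fixpoint_norm_le (Ptr := Ptr) (pol := pol theta) gamma0 gamma1
    (u := E)) => // y; rewrite EE normrM ler_pM//.
    by have [] := taylor y.
  exact: Q_norm_le.
have Q'Q_le z : `|Q' z - Q theta z| <= M * enorm h * UQ / (1 - gamma).
  rewrite Q'QE normrM ger0_norm//.
  rewrite (le_trans _ (mean_norm_le (mst z) bE E_le))// ler_piMl// ltW//.
pose u z := E z - tangent h z.
have bu : bounded_measurable u := bounded_measurableB bE (bounded_measurable_tangent h).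
have bt : bounded_measurable (tangent h) := bounded_measurable_tangent h.
have kE : kint (pol theta) E s0 =
    kint (pol (h + theta)) (Q (h + theta)) s0 - kint (pol theta) (Q theta) s0.
  rewrite (kint_policy_shift s0 hr bQ'); exact: (meanB mk bwQ' bQ).
rewrite dot_policy_gradient -kE -(meanB mk bE bt).
apply: (mean_norm_le mk bu) => z.
rewrite mulrAC.
apply: (step_fixpoint_norm_le (Ptr := Ptr) (pol := pol theta) gamma0 gamma1
  (u := u) z bu) => y.
rewrite (meanB (mst y) bE bt).
(* The first product yields the term in [ratio_const], the second, a product of two first-order
   quantities, the term in [M ^+ 2]; the outer division by [1 - gamma] is the contraction. *)
have -> : u y - gamma * (step Ptr (pol theta) E y - step Ptr (pol theta) (tangent h) y) =
    (w h y - 1 - dot (phi y) h) * Q theta y + (w h y - 1) * (Q' y - Q theta y).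
  have := EE y; have := tangentE h y; rewrite /u => e1 e2.
  transitivity ((E y - gamma * step Ptr (pol theta) E y) -
    (tangent h y - gamma * step Ptr (pol theta) (tangent h) y)); first by ring.
  by rewrite e1 e2; ring.
have [t1 t2] := taylor y.
rewrite (le_trans (ler_normD _ _))// [leRHS]mulrDl lerD// normrM.
  by rewrite [leRHS]mulrAC ler_pM// Q_norm_le.
rewrite (_ : _ * _ * enorm h ^+ 2 =
  M * enorm h * (M * enorm h * UQ / (1 - gamma))); last by ring.
by rewrite ler_pM.
Qed.

Lemma gradient_performance :
  let J theta := kint (pol theta) (potential gamma Ptr (pol theta) r) s0 in
  differentiable J theta /\ gradient J theta = policy_gradient.
Proof.
move=> J; apply: (differentiable_quadratic radius_gt0) => h hr.
exact: policy_gradient_expansion.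
Qed.

End policy_gradient.

(** * Geometric horizons *)

Lemma dsumZ {R : realType} (q c C : R) (u : R^nat) : 0 <= q -> q < 1 ->
  (forall t, `|u t| <= C) -> dsum q (fun t => c * u t) = c * dsum q u.
Proof.
move=> q0 q1 uC; apply: (cvg_lim (@Rhausdorff R)).
rewrite (_ : series _ = fun n => c * series (fun t => q ^+ t * u t) n).
  by apply: cvgMl_tmp; exact: (dsum_cvg q0 q1 uC).
apply/funext => n; rewrite /series /= mulr_sumr; apply: eq_bigr => t _.
by rewrite mulrCA.
Qed.

Lemma dsum_expM {R : realType} (q : R) (u : R^nat) :
  dsum q (fun t => q ^+ t * u t) = dsum (q ^+ 2) u.
Proof.
rewrite /dsum; congr (lim (series _ @ \oo)); apply/funext => t.
by rewrite mulrA -exprMn expr2.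
Qed.

(** Turns a sum with a random number of terms into a series with survival indicators, to which
    [mean_dsum] applies term by term. *)
Lemma dsum_truncated {R : realType} (q : R) (u : R^nat) n :
  dsum q (fun t => (t <= n)%:R * u t) = \sum_(t < n.+1) q ^+ t * u t.
Proof.
apply: (cvg_lim (@Rhausdorff R)); apply: cvg_near_cst; near=> N.
have nN : (n.+1 <= N)%N by near: N; exact: nbhs_infty_ge.
rewrite /series /= (big_cat_nat (leq0n _) nN)//= [X in _ + X]big_nat_cond.
rewrite [X in _ + X]big1 => [|t /andP[/andP[nt _] _]]; last first.
  by rewrite leqNgt nt mul0r mulr0.
rewrite addr0 big_mkord; apply: eq_bigr => t _.
by rewrite -ltnS ltn_ord mul1r.
Unshelve. all: by end_near.
Qed.

Lemma adapted_at_time dO (Omega : measurableType dO) (G : set_system Omega)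
    dX (X : measurableType dX) (T : Omega -> nat) (x : nat -> Omega -> X) :
  adapted G T -> (forall n, adapted G (x n)) -> adapted G (fun w => x (T w) w).
Proof.
move=> aT ax B mB.
rewrite (_ : _ @^-1` B = \bigcup_n (T @^-1` [set n] `&` x n @^-1` B)); last first.
  apply/seteqP; split => [w Bw|w [n _ [/= <-]]//].
  by exists (T w).
apply: (@bigcupT_measurable _ (g_sigma_algebraType G)) => n.
apply: (@measurableI _ (g_sigma_algebraType G)); first exact: aT.
exact: ax.
Qed.

Lemma indic_preimage_pred {R : realType} T U (f : T -> U) (b : pred U) w :
  \1_(f @^-1` [set u | b u]) w = (b (f w))%:R :> R.
Proof.
rewrite indicE; congr (_%:R); congr nat_of_bool.
by apply/idP/idP; rewrite inE.
Qed.

Section geometric_horizon.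
Context {R : realType} {dO : measure_display} {Omega : measurableType dO}.
Variables (P : probability Omega R) (G : set_system Omega) (q : R) (T : Omega -> nat).
Hypotheses (GO : G `<=` measurable) (TP : drawn P G T (fun=> geometric_law q)).
Hypotheses (q0 : 0 <= q) (q1 : q < 1).

Let mT : measurable_fun setT T. Proof. exact: TP.1. Qed.

Let mTB B : measurable (T @^-1` B).
Proof. by rewrite -[X in measurable X]setTI; exact: mT. Qed.

Lemma geometric_law_eq E n : <<s G >> E ->
  \int[P]_w \1_(E `&` T @^-1` [set n]) w = (1 - q) * q ^+ n * \int[P]_w \1_E w.
Proof.
move=> GE; have mE : measurable E.
  exact: (smallest_sub (@sigma_algebra_measurable _ Omega) GO).
rewrite !bint_indic//; last exact: measurableI.
transitivity (fine (P (E `&` T @^-1` [set n]))) => //.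
have gE : geometric_law q [set n] = ((1 - q) * q ^+ n)%:E.
  apply: esum_set1; rewrite lee_fin mulr_ge0 ?exprn_ge0// subr_ge0.
  exact: ltW.
by rewrite (TP.2 E [set n] GE)// gE integral_cst// fineM// fin_num_measure.
Qed.

(** Induction on [n]: removing the mass [(1 - q) * q ^+ n] of the value [n] from the tail [q ^+ n]
    leaves [q ^+ n.+1], so no series has to be summed. *)
Lemma geometric_law_ge E n : <<s G >> E ->
  \int[P]_w \1_(E `&` T @^-1` [set m | (n <= m)%N]) w = q ^+ n * \int[P]_w \1_E w.
Proof.
move=> GE; have mE : measurable E.
  exact: (smallest_sub (@sigma_algebra_measurable _ Omega) GO).
elim: n => [|n IH].
  rewrite expr0 mul1r (_ : [set m | _] = setT) ?preimage_setT ?setIT//.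
  by apply/seteqP; split.
have bE B : bounded_measurable (\1_(E `&` T @^-1` B) : Omega -> R).
  by apply: bounded_measurable_indic; exact: measurableI.
have : \int[P]_w (\1_(E `&` T @^-1` [set n]) w + \1_(E `&` T @^-1` [set m | (n < m)%N]) w) =
    q ^+ n * \int[P]_w \1_E w.
  rewrite -IH; apply: eq_Rintegral => w _; rewrite !indicI /= -mulrDr; congr (_ * _).
  rewrite (_ : [set n] = [set m | m == n]); last first.
    by apply/seteqP; split => m /eqP.
  rewrite !indic_preimage_pred [in RHS]leq_eqVlt eq_sym.
  by case: ltngtP => _ /=; rewrite ?add0r ?addr0.
rewrite bintD//; last exact: probability_setT.
by rewrite geometric_law_eq// => /(canRL (addKr _)) ->; rewrite exprS; ring.
Qed.

End geometric_horizon.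

(** * The simulated estimators *)

(** Links the value, an expectation over trajectories, to the operators: by [state_rollout_integral]
    with constant weight one, the reward at time [t] has mean [K^t r] averaged over the first
    action. *)
Lemma value_potential {R : realType} {dO dS dA : measure_display}
    {Omega : measurableType dO} {S : measurableType dS} {A : measurableType dA}
    (P : probability Omega R) (Ptr : R.-pker S * A ~> S) (pol : R.-pker S ~> A)
    (r : S * A -> R) (gamma : R) (s : S) st ac :
  0 <= gamma -> gamma < 1 -> bounded_measurable r ->
  state_rollout P set0 Ptr pol (cst s) st ac ->
  value P gamma r st ac = kint pol (potential gamma Ptr pol r) s.
Proof.
move=> gamma0 gamma1 br roll; have [C C0 rC] := bounded_measurable_ge0 br.
have [mst _] := state_rollout_measurable roll.
transitivity (\int[P]_w dsum gamma (fun t => r (st t w, ac t w))).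
  by rewrite /value unlock.
have mP : mean (fun f : Omega -> R => \int[P]_w f w).
  by apply: mean_bint; exact: probability_setT.
rewrite (mean_dsum gamma0 gamma1 mP (C := C)
  (u := fun t w => r (st t w, ac t w)))//; last first.
  by move=> t; exact: (bounded_measurable_comp br (mst t)).
rewrite (mean_dsum gamma0 gamma1 (mean_kint pol s) (C := C)
  (u := fun t => iter t (step Ptr pol) r)); last 2 first.
- by move=> t; exact: bounded_measurable_iter_step.
- by move=> t z; exact: iter_step_norm_le.
congr dsum; apply/funext => t.
transitivity (\int[P]_w (1 * r (st t w, ac t w))).
  by apply: eq_Rintegral => w _; rewrite mul1r.
rewrite (state_rollout_integral (F := cst 1) _ _ t roll)//.
- rewrite -[RHS](@bint_cst _ _ _ P); last exact: probability_setT.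
  by apply: eq_Rintegral => w _; rewrite mul1r.
- by apply/adaptedP; exact: measurable_cst.
- by exists 1 => w; rewrite normr1.
Qed.

Section simulation.
Context {R : realType} {dW dS dA : measure_display}.
Context {W : measurableType dW} {S : measurableType dS} {A : measurableType dA}.
Variables (P : probability W R) (gamma : R) (Ptr : R.-pker S * A ~> S).
Variables (pol : R.-pker S ~> A) (s0 : S) (X : simulation W S A).
Hypotheses (gamma_gt0 : 0 < gamma) (gamma_lt1 : gamma < 1).
Hypothesis simX : simulated P gamma Ptr pol s0 X.

Let gamma_ge0 : 0 <= gamma. Proof. exact: ltW. Qed.

Let mean_P : mean (fun f : W -> R => \int[P]_w f w).
Proof. by apply: mean_bint; exact: probability_setT. Qed.

Let q := Num.sqrt gamma.
Let q0 : 0 <= q. Proof. exact: sqrtr_ge0. Qed.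
Let q1 : q < 1. Proof. by rewrite -sqrtr1 ltr_sqrt. Qed.
Let qq : q ^+ 2 = gamma. Proof. by rewrite sqr_sqrtr. Qed.

Let last_pair w := (last_state X w, last_action X w).

Lemma known_horizons_measurable : known_horizons X `<=` measurable.
Proof.
have m1 := (horP simX).1; have m2 := (horQP simX).1.
have m3 := (horVP simX).1; have m4 := (horNP simX).1.
by rewrite !subUset; do !split; exact: events_of_measurable.
Qed.

Lemma known_main_measurable : known_main X `<=` measurable.
Proof.
rewrite subUset; split; first exact: known_horizons_measurable.
by have [] := state_rollout_measurable (mainP simX).
Qed.

Lemma adapted_last_pair : adapted (known_main X) last_pair.
Proof.
apply: (adapted_at_time (T := hor X) (x := fun n w => (st X n w, ac X n w))).
  by apply: adapted_events => B hB; left; left; left; left.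
move=> n; apply: adapted_pair; apply: adapted_events => B hB; right; exists n => //.
- by left.
- by right.
Qed.

Lemma known_next_measurable : known_next X `<=` measurable.
Proof.
rewrite subUset; split; first exact: known_main_measurable.
by apply: events_of_measurable; exact: (nextP simX).1.
Qed.

Lemma measurable_last_pair : measurable_fun setT last_pair.
Proof. exact: adapted_measurable known_main_measurable adapted_last_pair. Qed.

Let measurable_last_state : measurable_fun setT (last_state X).
Proof. exact: (measurableT_comp measurable_fst measurable_last_pair). Qed.

Let measurable_last_action : measurable_fun setT (last_action X).
Proof. exact: (measurableT_comp measurable_snd measurable_last_pair). Qed.

Lemma known_Q_measurable : known_Q X `<=` measurable.
Proof.
rewrite subUset; split; first exact: known_next_measurable.
by have [] := pair_rollout_measurable (rollQP simX).
Qed.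

Lemma known_V_measurable : known_V X `<=` measurable.
Proof.
rewrite subUset; split; first exact: known_Q_measurable.
by have [] := state_rollout_measurable (rollVP simX).
Qed.

(** What the three rollout horizons share: they are known before the main trajectory, and their
    survival probabilities factor from the law of the main horizon. *)
Definition rollout_horizon (H : W -> nat) : Prop :=
  adapted (known_horizons X) H /\
  forall n t, \int[P]_w (((t <= H w)%N)%:R * ((hor X w == n)%:R)) =
    q ^+ t * ((1 - gamma) * gamma ^+ n).

Let rollout_horizon_drawn G H : events_of (hor X) `<=` G -> G `<=` known_horizons X ->
  events_of H `<=` known_horizons X ->
  drawn P G H (fun=> geometric_law q) -> rollout_horizon H.
Proof.
move=> horG GX HX HP; split; first exact: adapted_events.
have set0O : (set0 : set_system W) `<=` measurable by [].
have GO : G `<=` measurable := subset_trans GX known_horizons_measurable.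
move=> n t; pose E := hor X @^-1` [set m | m == n].
have GE : <<s G >> E by exact: (adapted_events horG).
transitivity (\int[P]_w \1_(E `&` H @^-1` [set m | (t <= m)%N]) w).
  by apply: eq_Rintegral => w _; rewrite indicI /= !indic_preimage_pred mulrC.
rewrite (geometric_law_ge GO HP q0 q1)//; congr (_ * _).
(* The law of the main horizon alone: nothing is drawn before it, and the past event is the whole
   space. *)
have := geometric_law_eq set0O (horP simX) gamma_ge0 gamma_lt1 n
  (@measurableT _ (g_sigma_algebraType set0)).
rewrite setTI indicT bint_cst ?mulr1; last exact: probability_setT.
move=> <-; rewrite /E; congr (Rintegral _ _ \1_(_ @^-1` _)).
by apply/seteqP; split => m /eqP.
Qed.

Lemma rollout_horizonQ : rollout_horizon (horQ X).
Proof.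
apply: (rollout_horizon_drawn _ _ _ (horQP simX)) => // B hB; do 2 left.
  by left.
by right.
Qed.

Lemma rollout_horizonV : rollout_horizon (horV X).
Proof.
apply: (rollout_horizon_drawn _ _ _ (horVP simX)) => B hB.
- by left.
- by do 2 left.
- by left; right.
Qed.

Lemma rollout_horizonN : rollout_horizon (horN X).
Proof.
apply: (rollout_horizon_drawn _ _ _ (horNP simX)) => B hB.
- by do 2 left.
- by left.
- by right.
Qed.

Let horizon_adapted H t : rollout_horizon H ->
  adapted (known_horizons X) (fun w => ((t <= H w)%N)%:R : R).
Proof.
move=> [aH _]; apply: (adapted_comp (f := fun n => ((t <= n)%N)%:R : R) aH).
by move=> _ B mB.
Qed.

Let le1_nat (b : bool) : `|b%:R : R| <= 1.
Proof. by case: b; rewrite ?normr1 ?normr0. Qed.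

(** Splitting over the value [n] of the main horizon, the horizons contribute
    [q ^+ t * ((1 - gamma) * gamma ^+ n)] and the trajectory contributes the mean of [K^n Phi]; the
    sum over [n] is the potential. *)
Lemma last_pair_law H t Phi : rollout_horizon H -> bounded_measurable Phi ->
  \int[P]_w (((t <= H w)%N)%:R * Phi (last_pair w)) =
  q ^+ t * ((1 - gamma) * kint pol (potential gamma Ptr pol Phi) s0).
Proof.
move=> HP bPhi; have [C C0 PhiC] := bounded_measurable_ge0 bPhi.
have aH := horizon_adapted t HP.
pose F w : R := ((t <= H w)%N)%:R.
have mst n : measurable_fun setT (fun w => (st X n w, ac X n w)).
  by have [] := state_rollout_measurable (mainP simX).
pose v n w := F w * (hor X w == n)%:R * Phi (st X n w, ac X n w).
have ahor n : adapted (known_horizons X) (fun w => (hor X w == n)%:R : R).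
  apply: (adapted_comp (f := fun m => ((m == n))%:R : R)); last by move=> _ B mB.
  by apply: adapted_events => B hB; left; left; left.
have aF n : adapted (known_horizons X) (fun w => F w * (hor X w == n)%:R).
  exact: adaptedM.
have FC n w : `|F w * (hor X w == n)%:R| <= 1.
  by rewrite normrM mulr_ile1 ?normr_ge0//; exact: le1_nat.
(* The weight involves horizons only, all known before the main trajectory, so it can stand in front
   of the rollout. *)
have vint n : \int[P]_w v n w = q ^+ t * ((1 - gamma) * gamma ^+ n) *
    kint pol (iter n (step Ptr pol) Phi) s0.
  rewrite (state_rollout_integral known_horizons_measurable _ n (mainP simX))//; last first.
    by exists 1.
  rewrite -(HP.2 n t) [RHS]mulrC -(meanZ mean_P).
    by apply: eq_Rintegral => w _; rewrite mulrC.
  split; last by exists 1; exact: FC.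
  exact: adapted_measurable known_horizons_measurable (aF n).
pose Fn N w := series (v ^~ w) N.
(* At most one term of the partial sum is nonzero, the one whose index is the main horizon. *)
have FnE N w : Fn N w = (hor X w < N)%:R * (F w * Phi (last_pair w)).
  rewrite /Fn /series /=; have [lt|ge] := ltnP (hor X w) N.
    rewrite (bigD1_seq (hor X w)) ?mem_index_iota ?iota_uniq//= big1 => [|i].
      by rewrite /v eqxx mulr1 mul1r addr0.
    by rewrite eq_sym => /negbTE h; rewrite /v h mulr0 mul0r.
  rewrite mul0r big_nat_cond big1// => i /andP[/andP[_ iN] _].
  by rewrite /v gtn_eqF ?mulr0 ?mul0r// (leq_trans iN).
have lim1 : \int[P]_w Fn N w @[N --> \oo] --> \int[P]_w (F w * Phi (last_pair w)).
  apply: (mean_cvg mean_P (C := C)).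
  - move=> N; rewrite (_ : Fn N = fun w => \sum_(i < N) v i w); last first.
      by apply/funext => w; rewrite /Fn /series /= big_mkord.
    apply: (bounded_measurable_sum (F := fun (i : 'I_N) => v i)) => i.
    apply: bounded_measurableM; last exact: (bounded_measurable_comp bPhi (mst i)).
    split; last by exists 1; exact: FC.
    exact: adapted_measurable known_horizons_measurable (aF i).
  - move=> N w; rewrite FnE !normrM -[leRHS]mul1r ler_pM//.
    by rewrite -[leRHS]mul1r ler_pM//; exact: le1_nat.
  - move=> w; apply: cvg_near_cst; near=> N; rewrite FnE.
    rewrite (_ : (hor X w < N)%N) ?mul1r//; near: N; exact: nbhs_infty_gt.
have lim2 : \int[P]_w Fn N w @[N --> \oo] -->
    q ^+ t * ((1 - gamma) * kint pol (potential gamma Ptr pol Phi) s0).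
  rewrite (mean_dsum gamma_ge0 gamma_lt1 (mean_kint pol s0) (C := C)
    (u := fun t => iter t (step Ptr pol) Phi)); last 2 first.
  - by move=> n; exact: bounded_measurable_iter_step.
  - by move=> n z; exact: iter_step_norm_le.
  rewrite (_ : (fun N => _) = fun N => q ^+ t * ((1 - gamma) *
      series (fun n => gamma ^+ n * kint pol (iter n (step Ptr pol) Phi) s0) N)).
    do 2 apply: cvgMl_tmp; apply: (dsum_cvg gamma_ge0 gamma_lt1 (C := C)) => n.
    apply: (mean_norm_le (mean_kint pol s0)).
      exact: bounded_measurable_iter_step.
    by move=> z; exact: iter_step_norm_le.
  apply/funext => N; rewrite /Fn /series /= !mulr_sumr big_mkord.
  under eq_Rintegral do rewrite big_mkord.
  rewrite (mean_sum mean_P (F := fun (i : 'I_N) => v i)); last first.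
    move=> i; apply: bounded_measurableM;
      last exact: (bounded_measurable_comp bPhi (mst i)).
    split; last by exists 1; exact: FC.
    exact: adapted_measurable known_horizons_measurable (aF i).
  by apply: eq_bigr => i _; rewrite vint; ring.
exact: (cvg_unique (@Rhausdorff R) lim1 lim2).
Unshelve. all: by end_near.
Qed.

Lemma last_pair_integral Phi : bounded_measurable Phi ->
  \int[P]_w Phi (last_pair w) =
  (1 - gamma) * kint pol (potential gamma Ptr pol Phi) s0.
Proof.
move=> bPhi; have := last_pair_law 0 rollout_horizonQ bPhi.
rewrite expr0 mul1r => <-; apply: eq_Rintegral => w _.
by rewrite leq0n mul1r.
Qed.

Variables (r : S * A -> R) (U_R : R).
Hypotheses (r_meas : measurable_fun setT r) (r_le : forall z, `|r z| <= U_R).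

Let bounded_measurable_r : bounded_measurable r. Proof. by split => //; exists U_R. Qed.

Lemma rollout_estimateE (H : W -> nat) (st : nat -> W -> S) (ac : nat -> W -> A) w :
  rollout_estimate gamma r H st ac w =
  dsum q (fun t => ((t <= H w)%N)%:R * r (st t w, ac t w)).
Proof. by rewrite dsum_truncated. Qed.

Lemma rollout_estimate_norm_le (H : W -> nat) (st : nat -> W -> S)
    (ac : nat -> W -> A) w :
  `|rollout_estimate gamma r H st ac w| <= U_R / (1 - q).
Proof.
rewrite rollout_estimateE; apply: dsum_norm_le => // t.
by rewrite normrM -[leRHS]mul1r ler_pM//; exact: le1_nat.
Qed.

Section rollout_estimate.
Variables (H : W -> nat) (st : nat -> W -> S) (ac : nat -> W -> A).
Hypothesis HP : rollout_horizon H.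
Hypothesis mst : forall t, measurable_fun setT (fun w => (st t w, ac t w)).

Let bounded_measurable_term t :
  bounded_measurable (fun w => ((t <= H w)%N)%:R * r (st t w, ac t w)).
Proof.
apply: bounded_measurableM;
  last exact: (bounded_measurable_comp bounded_measurable_r (mst t)).
split; last by exists 1 => w; exact: le1_nat.
exact: adapted_measurable known_horizons_measurable (horizon_adapted t HP).
Qed.

Lemma bounded_measurable_rollout_estimate :
  bounded_measurable (rollout_estimate gamma r H st ac).
Proof.
rewrite (_ : rollout_estimate _ _ _ _ _ =
  fun w => dsum q (fun t => ((t <= H w)%N)%:R * r (st t w, ac t w))); last first.
  by apply/funext => w; exact: rollout_estimateE.
apply: (bounded_measurable_dsum q0 q1 (C := U_R)
  (u := fun t w => ((t <= H w)%N)%:R * r (st t w, ac t w))) => // t w.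
by rewrite normrM -[leRHS]mul1r ler_pM//; exact: le1_nat.
Qed.

(* The weights [q ^+ t] and the survival probabilities [q ^+ t] of the horizon
   multiply to [gamma ^+ t]. *)
Lemma rollout_estimate_integral (u : nat -> S * A -> R) C Phi :
  (forall t, bounded_measurable (u t)) -> (forall t z, `|u t z| <= C) ->
  bounded_measurable Phi ->
  (forall t, \int[P]_w (((t <= H w)%N)%:R * Phi (last_pair w) * r (st t w, ac t w)) =
     \int[P]_w (((t <= H w)%N)%:R * Phi (last_pair w) * u t (last_pair w))) ->
  \int[P]_w (Phi (last_pair w) * rollout_estimate gamma r H st ac w) =
  (1 - gamma) * kint pol (potential gamma Ptr pol
    (fun z => Phi z * dsum gamma (fun t => u t z))) s0.
Proof.
move=> bu uC bPhi uE; have [D D0 PhiD] := bounded_measurable_ge0 bPhi.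
have bPhiL := bounded_measurable_comp bPhi measurable_last_pair.
have U0 : 0 <= U_R := le_trans (normr_ge0 _) (r_le (s0, point)).
have C0 : 0 <= C := le_trans (normr_ge0 _) (uC 0%N (s0, point)).
have rt_le t w : `|((t <= H w)%N)%:R * r (st t w, ac t w)| <= U_R.
  by rewrite normrM -[leRHS]mul1r ler_pM//; exact: le1_nat.
have bPhiu t : bounded_measurable (fun z => Phi z * u t z) by exact: bounded_measurableM.
have Phiu_le t z : `|Phi z * u t z| <= D * C by rewrite normrM ler_pM.
(* The normalised discounted occupancy, which is the law of the last pair. *)
pose L f := (1 - gamma) * kint pol (potential gamma Ptr pol f) s0.
have LE f : bounded_measurable f -> L f = \int[P]_w f (last_pair w).
  by move=> bf; rewrite last_pair_integral.
transitivity (dsum gamma (fun t => L (fun z => Phi z * u t z))); last first.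
  rewrite -/(L _) LE; last first.
    apply: bounded_measurableM => //.
    exact: (bounded_measurable_dsum gamma_ge0 gamma_lt1 bu uC).
  transitivity (dsum gamma (fun t => \int[P]_w (Phi (last_pair w) * u t (last_pair w)))).
    by congr dsum; apply/funext => t; rewrite LE.
  rewrite -(mean_dsum gamma_ge0 gamma_lt1 mean_P (C := D * C)
    (u := fun t w => Phi (last_pair w) * u t (last_pair w)))//.
    by apply: eq_Rintegral => w _; rewrite (dsumZ _ gamma_ge0 gamma_lt1 (C := C)).
  by move=> t; exact: (bounded_measurable_comp (bPhiu t) measurable_last_pair).
rewrite -[X in _ = dsum X _]qq -dsum_expM.
transitivity (\int[P]_w (dsum q (fun t =>
    Phi (last_pair w) * (((t <= H w)%N)%:R * r (st t w, ac t w))))).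
  apply: eq_Rintegral => w _; rewrite rollout_estimateE.
  by rewrite (dsumZ _ q0 q1 (C := U_R)).
rewrite (mean_dsum q0 q1 mean_P (C := D * U_R) (u := fun t w =>
    Phi (last_pair w) * (((t <= H w)%N)%:R * r (st t w, ac t w)))).
- congr dsum; apply/funext => t; rewrite /L -(last_pair_law t HP (bPhiu t)).
  transitivity (\int[P]_w (((t <= H w)%N)%:R * Phi (last_pair w) * r (st t w, ac t w))).
    by apply: eq_Rintegral => w _; ring.
  by rewrite uE; apply: eq_Rintegral => w _; ring.
- by move=> t; exact: bounded_measurableM.
- by move=> t w; rewrite normrM ler_pM.
Qed.

End rollout_estimate.

Let adapted_weight H t Phi (G : set_system W) :
  rollout_horizon H -> bounded_measurable Phi ->
  known_main X `<=` G ->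
  adapted G (fun w => ((t <= H w)%N)%:R * Phi (last_pair w) : R) /\
  exists D, forall w, `|((t <= H w)%N)%:R * Phi (last_pair w)| <= D.
Proof.
move=> HP bPhi mainG; split.
  apply: adapted_sub mainG _; apply: adaptedM.
    by apply: adapted_sub (horizon_adapted t HP); exact: subsetUl.
  by apply: (adapted_comp adapted_last_pair); exact: bPhi.1.
have [D D0 PhiD] := bounded_measurable_ge0 bPhi; exists D => w.
by rewrite normrM -[leRHS]mul1r ler_pM//; exact: le1_nat.
Qed.

Let main_next : known_main X `<=` known_next X. Proof. exact: subsetUl. Qed.
Let main_Q : known_main X `<=` known_Q X.
Proof. exact: subset_trans main_next (@subsetUl _ _ _). Qed.
Let main_V : known_main X `<=` known_V X.
Proof. exact: subset_trans main_Q (@subsetUl _ _ _). Qed.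

Let Q := potential gamma Ptr pol r.

Let bounded_measurable_iter_r t : bounded_measurable (iter t (step Ptr pol) r).
Proof. exact: bounded_measurable_iter_step. Qed.

Let iter_r_le t z : `|iter t (step Ptr pol) r z| <= U_R.
Proof. exact: iter_step_norm_le. Qed.

Lemma bounded_measurable_Qhat : bounded_measurable (Qhat gamma r X).
Proof.
have [mst _] := pair_rollout_measurable (rollQP simX).
exact: bounded_measurable_rollout_estimate rollout_horizonQ mst.
Qed.

Lemma bounded_measurable_Vhat : bounded_measurable (Vhat gamma r X).
Proof.
have [mst _] := state_rollout_measurable (rollVP simX).
exact: bounded_measurable_rollout_estimate rollout_horizonV mst.
Qed.

Lemma bounded_measurable_Vhat_next : bounded_measurable (Vhat_next gamma r X).
Proof.
have [mst _] := state_rollout_measurable (rollNP simX).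
exact: bounded_measurable_rollout_estimate rollout_horizonN mst.
Qed.

Lemma Qhat_integral Phi : bounded_measurable Phi ->
  \int[P]_w (Phi (last_pair w) * Qhat gamma r X w) =
  (1 - gamma) * kint pol (potential gamma Ptr pol (fun z => Phi z * Q z)) s0.
Proof.
move=> bPhi; have [mst _] := pair_rollout_measurable (rollQP simX).
apply: (rollout_estimate_integral rollout_horizonQ mst (C := U_R)
  (u := fun t => iter t (step Ptr pol) r)) => // t.
have [aF bF] := adapted_weight t rollout_horizonQ bPhi main_next.
by rewrite (pair_rollout_integral known_next_measurable _ _ t (rollQP simX)).
Qed.

Lemma Vhat_integral Phi : bounded_measurable Phi ->
  \int[P]_w (Phi (last_pair w) * Vhat gamma r X w) =
  (1 - gamma) * kint pol (potential gamma Ptr pol (fun z => Phi z * kint pol Q z.1)) s0.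
Proof.
move=> bPhi; have [mst _] := state_rollout_measurable (rollVP simX).
have bv t : bounded_measurable (fun z : S * A => kint pol (iter t (step Ptr pol) r) z.1).
  apply: (bounded_measurable_comp (f := kint pol (iter t (step Ptr pol) r))) => //.
  exact: bounded_measurable_kint.
have vU t (z : S * A) : `|kint pol (iter t (step Ptr pol) r) z.1| <= U_R.
  exact: (mean_norm_le (mean_kint pol z.1)).
rewrite (rollout_estimate_integral rollout_horizonV mst (C := U_R)
  (u := fun t z => kint pol (iter t (step Ptr pol) r) z.1))//.
  congr (_ * kint pol (potential gamma Ptr pol _) s0); apply/funext => z.
  by rewrite /Q (mean_dsum gamma_ge0 gamma_lt1 (mean_kint pol z.1) (C := U_R)).
move=> t; have [aF bF] := adapted_weight t rollout_horizonV bPhi main_Q.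
by rewrite (state_rollout_integral known_Q_measurable _ t (rollVP simX)).
Qed.

(** The rollout starts one transition after the last pair, hence the index [t.+1]: its first action
    is averaged by the rollout itself, its starting state by the law of [nxt]. The resulting sum is
    [step] applied to the action value. *)
Lemma Vhat_next_integral Phi : bounded_measurable Phi ->
  \int[P]_w (Phi (last_pair w) * Vhat_next gamma r X w) =
  (1 - gamma) * kint pol (potential gamma Ptr pol (fun z => Phi z * step Ptr pol Q z)) s0.
Proof.
move=> bPhi; have [mst _] := state_rollout_measurable (rollNP simX).
rewrite (rollout_estimate_integral rollout_horizonN mst (C := U_R)
  (u := fun t => iter t.+1 (step Ptr pol) r))//.
  congr (_ * kint pol (potential gamma Ptr pol _) s0); apply/funext => z.
  by rewrite /Q step_potential.
move=> t; have [aF bF] := adapted_weight t rollout_horizonN bPhi main_V.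
rewrite (state_rollout_integral known_V_measurable (nextP simX).1 t (rollNP simX))//.
have [aF' _] := adapted_weight t rollout_horizonN bPhi (@subset_refl _ (known_main X)).
rewrite (drawn_integral known_main_measurable (nextP simX) adapted_last_pair
  (f := kint pol (iter t (step Ptr pol) r) \o snd))//.
by apply: bounded_measurable_comp => //; exact: bounded_measurable_kint.
Qed.

End simulation.

(** A function with mean zero under the policy at every state is killed by [step], so its potential
    is the function itself. *)
Lemma kint_potential_centered {R : realType} {dS dA : measure_display}
    {S : measurableType dS} {A : measurableType dA} (gamma : R)
    (Ptr : R.-pker S * A ~> S) (pol : R.-pker S ~> A) (f : S * A -> R) s :
  0 <= gamma -> gamma < 1 -> bounded_measurable f -> (forall s, kint pol f s = 0) ->
  kint pol (potential gamma Ptr pol f) s = 0.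
Proof.
move=> gamma0 gamma1 bf f0.
have bp : bounded_measurable (potential gamma Ptr pol f).
  exact: bounded_measurable_potential.
have stepf0 z : step Ptr pol f z = 0.
  rewrite /step (_ : kint pol f = cst 0); last exact/funext.
  exact: (mean0 (mean_kint Ptr z)).
rewrite (_ : potential gamma Ptr pol f = f)//; apply/funext => z.
apply/eqP; rewrite -subr_eq0 -normr_le0 -[leRHS](mul0r (1 - gamma)^-1).
apply: (step_fixpoint_norm_le (Ptr := Ptr) (pol := pol) gamma0 gamma1
  (u := fun z => potential gamma Ptr pol f z - f z)).
  exact: bounded_measurableB.
move=> y; rewrite (meanB (mean_step Ptr pol y))// stepf0 subr0.
rewrite (potentialE Ptr pol gamma0 gamma1 y bf) (_ : _ - _ = 0) ?normr0//.
ring.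
Qed.

Lemma unbiased_bounded {R : realType} {dO : measure_display} {Omega : measurableType dO}
    (P : probability Omega R) d (g : Omega -> 'rV[R]_d) (v : 'rV[R]_d) :
  (forall i, bounded_measurable (fun w => g w ord0 i)) ->
  (forall i, \int[P]_w g w ord0 i = v ord0 i) -> unbiased P g v.
Proof.
move=> bg gv i; have ig := bounded_measurable_integrable (probability_setT P) (bg i).
split => //; rewrite -gv unlock /Rintegral fineK//.
exact: integrable_fin_num ig.
Qed.

Theorem theorem3p4 (R : realType) (d : nat)
  (* the Markov decision process *)
  (dS dA : measure_display) (S : measurableType dS) (A : measurableType dA)
  (hS : finite_or_compact R S) (hA : finite_or_compact R A)
  (Ptr : R.-pker S * A ~> S)
  (r : S * A -> R) (r_meas : measurable_fun setT r)
  (gamma : R) (gamma_gt0 : 0 < gamma) (gamma_lt1 : gamma < 1) (s0 : S)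
  (* the policies pi_theta, with densities p theta s a = pi_theta(a | s) *)
  (pol : 'rV[R]_d -> R.-pker S ~> A)
  (nu : {sigma_finite_measure set A -> \bar R})
  (p : 'rV[R]_d -> S -> A -> R)
  (p_meas : forall theta, measurable_fun setT (fun x : S * A => p theta x.1 x.2))
  (p_density : forall theta s (B : set A), measurable B ->
     pol theta s B = (\int[nu]_(a in B) (p theta s a)%:E)%E)
  (p_gt0 : forall theta s a, 0 < p theta s a)
  (p_diff : forall s a theta, differentiable (fun theta' => p theta' s a) theta)
  (* the assumptions on the reward and on the score *)
  (U_R L_Theta B_Theta : R)
  (r_bounded : forall s a, `|r (s, a)| <= U_R)
  (score_lipschitz : forall s a theta1 theta2,
     enorm (score p theta1 s a - score p theta2 s a)
       <= L_Theta * enorm (theta1 - theta2))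
  (score_bounded : forall s a theta, enorm (score p theta s a) <= B_Theta)
  (* Pr theta s is the law of the trajectory of pi_theta started at s *)
  (dO : measure_display) (Omega : measurableType dO)
  (Pr : 'rV[R]_d -> S -> probability Omega R)
  (Sproc : nat -> Omega -> S) (Aproc : nat -> Omega -> A)
  (trajectory : forall theta s,
     state_rollout (Pr theta s) set0 Ptr (pol theta) (cst s) Sproc Aproc) :
  let V theta s := value (Pr theta s) gamma r Sproc Aproc in
  let J theta := V theta s0 in
  forall theta : 'rV[R]_d,
    differentiable J theta
    /\ enorm (gradient J theta) <= B_Theta * U_R / (1 - gamma) ^+ 2
    /\ forall (dW : measure_display) (W : measurableType dW)
         (P : probability W R) (X : simulation W S A),
         simulated P gamma Ptr (pol theta) s0 X ->
         [/\ unbiased P (grad_hat gamma r p theta X) (gradient J theta),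
             unbiased P (grad_check gamma r p theta X) (gradient J theta) &
             unbiased P (grad_tilde gamma r p theta X) (gradient J theta)]
         /\
         [/\ {ae P, forall w, enorm (grad_hat gamma r p theta X w)
                <= B_Theta * U_R / ((1 - gamma) * (1 - Num.sqrt gamma))},
             {ae P, forall w, enorm (grad_check gamma r p theta X w)
                <= 2 * B_Theta * U_R / ((1 - gamma) * (1 - Num.sqrt gamma))} &
             {ae P, forall w, enorm (grad_tilde gamma r p theta X w)
                <= (2 + gamma - Num.sqrt gamma) * B_Theta * U_R
                     / ((1 - gamma) * (1 - Num.sqrt gamma))}].
Proof.
move=> V J theta.
have gamma_ge0 : 0 <= gamma := ltW gamma_gt0.
have r_le z : `|r z| <= U_R by case: z.
have br : bounded_measurable r by split => //; exists U_R.
have JE theta' : J theta' = kint (pol theta') (potential gamma Ptr (pol theta') r) s0.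
  exact: (value_potential gamma_ge0 gamma_lt1 br (trajectory theta' s0)).
have [dJ gJ] := gradient_performance Ptr gamma_ge0 gamma_lt1 r_meas r_bounded p_meas
  p_density p_gt0 p_diff score_lipschitz score_bounded theta s0.
have -> : J = fun theta' => kint (pol theta') (potential gamma Ptr (pol theta') r) s0.
  exact/funext.
split=> //; rewrite gJ; split.
  exact: (enorm_policy_gradient Ptr pol gamma_ge0 gamma_lt1 r_meas r_bounded p_meas
    p_gt0 p_diff score_bounded theta s0).
move=> dW W P X simX; set D := policy_gradient _ _ _ _ _ _ _.
have sqrt_lt1 : Num.sqrt gamma < 1 by rewrite -sqrtr1 ltr_sqrt.
have g1 : 0 < 1 - gamma by rewrite subr_gt0.
have q1 : 0 < 1 - Num.sqrt gamma by rewrite subr_gt0.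
have U0 : 0 <= U_R := le_trans (normr_ge0 _) (r_le (s0, point)).
have B0 : 0 <= B_Theta := le_trans (enorm_ge0 _) (score_bounded s0 point theta).
have estimate_le := rollout_estimate_norm_le gamma_lt1 r_le.
have Qhat_le w : `|Qhat gamma r X w| <= U_R / (1 - Num.sqrt gamma) by exact: estimate_le.
have Vhat_le w : `|Vhat gamma r X w| <= U_R / (1 - Num.sqrt gamma) by exact: estimate_le.
have Vnext_le w : `|Vhat_next gamma r X w| <= U_R / (1 - Num.sqrt gamma).
  exact: estimate_le.
pose L w := (last_state X w, last_action X w).
have mL : measurable_fun setT L := measurable_last_pair simX.
pose phi i (z : S * A) := score p theta z.1 z.2 ord0 i.
have bphi i : bounded_measurable (phi i).
  exact: (bounded_measurable_score p_meas p_gt0 p_diff score_bounded).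
have bphiL i : bounded_measurable (fun w => phi i (L w)).
  exact: (bounded_measurable_comp (bphi i) mL).
have bQ : bounded_measurable (potential gamma Ptr (pol theta) r).
  exact: bounded_measurable_potential.
have bsQ := bounded_measurable_step Ptr (pol theta) bQ.
have bQh := bounded_measurable_Qhat gamma_gt0 gamma_lt1 simX r_meas r_le.
have bVh := bounded_measurable_Vhat gamma_gt0 gamma_lt1 simX r_meas r_le.
have bVn := bounded_measurable_Vhat_next gamma_gt0 gamma_lt1 simX r_meas r_le.
have mP : mean (fun f : W -> R => \int[P]_w f w).
  by apply: mean_bint; exact: probability_setT.
have QI i : \int[P]_w (phi i (L w) * Qhat gamma r X w) = (1 - gamma) * D ord0 i.
  by rewrite (Qhat_integral gamma_gt0 gamma_lt1 simX r_meas r_le (bphi i)) mxE.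
have VI i : \int[P]_w (phi i (L w) * Vhat gamma r X w) = 0.
  rewrite (Vhat_integral gamma_gt0 gamma_lt1 simX r_meas r_le (bphi i)).
  rewrite kint_potential_centered ?mulr0//.
    apply: bounded_measurableM => //.
    apply: (bounded_measurable_comp (bounded_measurable_kint (pol theta) bQ)).
    exact: measurable_fst.
  (* At a fixed state the baseline does not depend on the action and leaves the average of the
     score. *)
  move=> s; pose c := kint (pol theta) (potential gamma Ptr (pol theta) r) s.
  transitivity (kint (pol theta) (fun z => c * phi i z) s).
    by apply: eq_Rintegral => a _; rewrite mulrC.
  rewrite (meanZ (mean_kint _ _))// (kint_score p_meas p_density p_gt0 p_diff
    score_lipschitz score_bounded) ?mulr0//.
(* By the Bellman equation, [r + gamma * step Q] is [Q]: the one-step target has the same weighted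
   mean as [Qhat]. *)
have NI i : \int[P]_w (phi i (L w) * r (L w)) +
    gamma * \int[P]_w (phi i (L w) * Vhat_next gamma r X w) = (1 - gamma) * D ord0 i.
  rewrite (Vhat_next_integral gamma_gt0 gamma_lt1 simX r_meas r_le (bphi i)).
  have bphis : bounded_measurable
      (fun z => phi i z * step Ptr (pol theta) (potential gamma Ptr (pol theta) r) z).
    exact: bounded_measurableM.
  rewrite -(last_pair_integral gamma_gt0 gamma_lt1 simX bphis) -/L -QI.
  rewrite (Qhat_integral gamma_gt0 gamma_lt1 simX r_meas r_le (bphi i)).
  have bphiQ : bounded_measurable (fun z => phi i z * potential gamma Ptr (pol theta) r z).
    exact: bounded_measurableM.
  rewrite -(last_pair_integral gamma_gt0 gamma_lt1 simX bphiQ) -/L.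
  rewrite -(meanZ mP); last exact: (bounded_measurable_comp bphis mL).
  rewrite -(meanD mP).
  - apply: eq_Rintegral => w _.
    rewrite (potentialE Ptr (pol theta) gamma_ge0 gamma_lt1 (L w) br); ring.
  - apply: bounded_measurableM => //; exact: (bounded_measurable_comp br mL).
  - apply: bounded_measurableZ; exact: (bounded_measurable_comp bphis mL).
have hatE i : (fun w => grad_hat gamma r p theta X w ord0 i) =
    fun w => (1 - gamma)^-1 * (phi i (L w) * Qhat gamma r X w).
  by apply/funext => w; rewrite mxE -mulrA; congr (_ * _); rewrite mulrC.
have checkE i : (fun w => grad_check gamma r p theta X w ord0 i) =
    fun w => (1 - gamma)^-1 *
      (phi i (L w) * Qhat gamma r X w - phi i (L w) * Vhat gamma r X w).
  by apply/funext => w; rewrite mxE -mulrA -mulrBr; congr (_ * _); rewrite mulrC.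
have tildeE i : (fun w => grad_tilde gamma r p theta X w ord0 i) =
    fun w => (1 - gamma)^-1 * ((phi i (L w) * r (L w)
      + gamma * (phi i (L w) * Vhat_next gamma r X w)) - phi i (L w) * Vhat gamma r X w).
  apply/funext => w; rewrite mxE -mulrA; congr (_ * _).
  by rewrite (mulrCA gamma) -mulrDr -mulrBr mulrC.
have bphiQ i : bounded_measurable (fun w => phi i (L w) * Qhat gamma r X w).
  exact: bounded_measurableM.
have bphiV i : bounded_measurable (fun w => phi i (L w) * Vhat gamma r X w).
  exact: bounded_measurableM.
have bphir i : bounded_measurable (fun w => phi i (L w) * r (L w)).
  by apply: bounded_measurableM => //; exact: (bounded_measurable_comp br mL).
have bphiN i : bounded_measurable (fun w => phi i (L w) * Vhat_next gamma r X w).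
  exact: bounded_measurableM.
have bgN i := bounded_measurableZ gamma (bphiN i).
have bQV i := bounded_measurableB (bphiQ i) (bphiV i).
have brN i := bounded_measurableD (bphir i) (bgN i).
have brNV i := bounded_measurableB (brN i) (bphiV i).
split; split.
- apply: unbiased_bounded => i; rewrite hatE; first exact: bounded_measurableZ.
  by rewrite (meanZ mP)// QI mulKf// gt_eqF.
- apply: unbiased_bounded => i; rewrite checkE; first exact: bounded_measurableZ.
  by rewrite (meanZ mP)// (meanB mP)// QI VI subr0 mulKf// gt_eqF.
- apply: unbiased_bounded => i; rewrite tildeE; first exact: bounded_measurableZ.
  by rewrite (meanZ mP)// (meanB mP)// (meanD mP)// (meanZ mP)// VI NI subr0 mulKf// gt_eqF.
- apply: aeW => w; rewrite enormZ normrM ger0_norm ?invr_ge0 ?(ltW g1)//.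
  rewrite [leRHS](_ : _ =
    (1 - gamma)^-1 * (U_R / (1 - Num.sqrt gamma)) * B_Theta); last first.
    by field; rewrite !gt_eqF.
  rewrite ler_pM ?enorm_ge0 ?mulr_ge0 ?invr_ge0 ?(ltW g1)//.
  by rewrite ler_wpM2l ?invr_ge0 ?(ltW g1).
- apply: aeW => w; rewrite enormZ normrM ger0_norm ?invr_ge0 ?(ltW g1)//.
  rewrite [leRHS](_ : _ = (1 - gamma)^-1 * (U_R / (1 - Num.sqrt gamma)
    + U_R / (1 - Num.sqrt gamma)) * B_Theta); last by field; rewrite !gt_eqF.
  rewrite ler_pM ?enorm_ge0 ?mulr_ge0 ?invr_ge0 ?(ltW g1)// ler_wpM2l ?invr_ge0 ?(ltW g1)//.
  by rewrite (le_trans (ler_normB _ _))// lerD.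
- apply: aeW => w; rewrite enormZ normrM ger0_norm ?invr_ge0 ?(ltW g1)//.
  (* The immediate reward is bounded by [U_R] without the factor [(1 - Num.sqrt gamma)^-1]; over the
     common denominator the numerators add up to [(1 - Num.sqrt gamma) + gamma + 1]. *)
  rewrite [leRHS](_ : _ = (1 - gamma)^-1 * (U_R + gamma * (U_R / (1 - Num.sqrt gamma))
    + U_R / (1 - Num.sqrt gamma)) * B_Theta); last by field; rewrite !gt_eqF.
  rewrite ler_pM ?enorm_ge0 ?mulr_ge0 ?invr_ge0 ?(ltW g1)// ler_wpM2l ?invr_ge0 ?(ltW g1)//.
  rewrite (le_trans (ler_normB _ _))// lerD// (le_trans (ler_normD _ _))// lerD//.
  by rewrite normrM ger0_norm// ler_wpM2l.
Qed.
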